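(* Let $u$ be a solution of the Navier–Stokes problem on $\mathbb{R}^3$ $$u_t-\nu\Delta u+(u\cdot\nabla)u+\nabla P=0,\qquad \nabla\cdot u=0,\qquad u|_{t=0}=u_0.$$ Assume that $u$ and $u_0$ have the (1,2)-symplectic representations $$u(t,x)=(A\times\nabla)\phi(t,x)+\{(B\times\nabla)\times\nabla\}\psi(t,x),$$ $$u_0(x)=(A\times\nabla)\phi_0(x)+\{(B\times\nabla)\times\nabla\}\psi_0(x),$$ where the vectors $A\in\mathbb{R}^3\setminus\{0\}$ and $B\in\mathbb{R}^3\setminus\{0\}$ are perpendicular to each other, $A\perp B$. Let $\phi_0(x)$ and $\psi_0(x)$ be regular enough. Then the functions $\phi(t,x)$ and $\psi(t,x)$ cannot (both) be radially symmetric functions of $x$ for any $t>0$, even if the initial data $\phi_0(x)$ and $\psi_0(x)$ are radially symmetric functions, except in the case that $$\phi_0=f_2r^2+f_0,\qquad \psi_0=g_4r^4+g_2r^2+g_0,\qquad f_2g_4=0,$$ where $f_j$ and $g_j$ ($j=0,2,4$) are arbitrary constants. In particular, if $u_0\neq0$ and $u_0\in L^2(\mathbb{R}^3)$, then the functions $\phi(t,x)$ and $\psi(t,x)$ cannot (both) be radially symmetric functions of $x$ for any $t>0$, even if the initial data $\phi_0(x)$ and $\psi_0(x)$ are radially symmetric functions.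
   Context: Here $\nu>0$ is the constant viscosity coefficient, $u=u(t,x)\in\mathbb{R}^3$ the velocity, $P$ the scalar pressure, $u_0$ the given initial velocity with $\nabla\cdot u_0=0$, $x\in\mathbb{R}^3$, $r=|x|$. For a constant vector $A$, $A\times\nabla$ is the vector of first-order operators given by the formal cross product, and $(B\times\nabla)\times\nabla=(B\cdot\nabla)\nabla-B\Delta$. The functions $\phi,\psi,\phi_0,\psi_0$ are real scalar functions. A function is radially symmetric in $x$ if it depends on $x$ only through $r$. ''Regular enough'' means as much regularity as is needed; the paper does not specify it further.
   Formalization: ''For any t>0'' is proved as ''for all sufficiently small t>0'': at later times it fails, e.g. u=0, ψ=0, φ=χ(t)A·x with χ(0)=1 and χ vanishing later. Also assumed: φ, ψ equal φ_0, ψ_0 at t=0 and are C^5 up to t=0. *)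

(* Defs.v *)
From HB Require Import structures.
From mathcomp Require Import all_boot all_order all_algebra.
From mathcomp Require Import all_classical all_reals all_analysis.

Set Implicit Arguments.
Unset Strict Implicit.
Unset Printing Implicit Defensive.

Import Order.TTheory GRing.Theory Num.Theory.
Import numFieldNormedType.Exports.

Local Open Scope classical_set_scope.
Local Open Scope ring_scope.

(** * Vector algebra in R^3 *)

Definition dot (R : realType) (x y : 'rV[R]_3) : R := \sum_i x 0 i * y 0 i.

(* The library norm [`|x|] on row vectors is the sup norm; r = |x| is this one. *)
Definition enorm (R : realType) (x : 'rV[R]_3) : R := Num.sqrt (dot x x).

Definition vec3 (R : realType) (a b c : R) : 'rV[R]_3 :=
  \row_(i < 3) [:: a; b; c]`_i.

Definition crossprod (R : realType) (x y : 'rV[R]_3) : 'rV[R]_3 :=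
  vec3 (x 0 1 * y 0 2 - x 0 2 * y 0 1)
       (x 0 2 * y 0 0 - x 0 0 * y 0 2)
       (x 0 0 * y 0 1 - x 0 1 * y 0 0).

(** * Differential operators in the space variable *)

Definition partial (R : realType) (V : normedModType R) (i : 'I_3)
  (f : 'rV[R]_3 -> V) : 'rV[R]_3 -> V := 'D_(delta_mx 0 i) f.

Definition grad (R : realType) (f : 'rV[R]_3 -> R) (x : 'rV[R]_3) : 'rV[R]_3 :=
  \row_i partial i f x.

Definition laplacian (R : realType) (V : normedModType R)
  (f : 'rV[R]_3 -> V) (x : 'rV[R]_3) : V := \sum_i partial i (partial i f) x.

Definition divergence (R : realType) (u : 'rV[R]_3 -> 'rV[R]_3) (x : 'rV[R]_3) : R :=
  \sum_i (partial i u x) 0 i.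

(* (w . nabla) f *)
Definition advect (R : realType) (V : normedModType R) (w : 'rV[R]_3)
  (f : 'rV[R]_3 -> V) (x : 'rV[R]_3) : V := \sum_i w 0 i *: partial i f x.

(* (A x nabla) f *)
Definition cross_nabla (R : realType) (A : 'rV[R]_3) (f : 'rV[R]_3 -> R)
  (x : 'rV[R]_3) : 'rV[R]_3 := crossprod A (grad f x).

(* {(B x nabla) x nabla} f = (B . nabla) nabla f - B Delta f *)
Definition cross_nabla_nabla (R : realType) (B : 'rV[R]_3) (f : 'rV[R]_3 -> R)
  (x : 'rV[R]_3) : 'rV[R]_3 := advect B (grad f) x - laplacian f x *: B.

Definition symplectic12 (R : realType) (A B : 'rV[R]_3) (phi psi : 'rV[R]_3 -> R)
  (x : 'rV[R]_3) : 'rV[R]_3 := cross_nabla A phi x + cross_nabla_nabla B psi x.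

(** * Regularity *)

(* [f] is C^k on the open set [U]: all iterated directional derivatives of
   order at most k exist and are continuous on [U]. *)
Fixpoint Ck_on (R : realType) (E V : normedModType R) (k : nat) (U : set E)
    (f : E -> V) : Prop :=
  (forall z, U z -> {for z, continuous f}) /\
  (if k is k'.+1 then
     forall v, (forall z, U z -> derivable f z v) /\ Ck_on k' U ('D_v f)
   else True).

(* [f] is C^k on [0, T) x R^3, up to and including t = 0: there it is the
   restriction of a function which is C^k on the open set {t < T}.  Only the
   values of [f t] for 0 <= t < T are constrained. *)
Definition Ck_slab (R : realType) (V : normedModType R) (k : nat) (T : R)
    (f : R -> 'rV[R]_3 -> V) : Prop :=
  exists F : R * 'rV[R]_3 -> V,
    Ck_on k [set z : R * 'rV[R]_3 | z.1 < T] F /\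
    forall t x, 0 <= t -> t < T -> f t x = F (t, x).

(** * The Navier-Stokes problem on [0, T) x R^3 *)

Record NS_solution (R : realType) (nu T : R) (u : R -> 'rV[R]_3 -> 'rV[R]_3)
    (P : R -> 'rV[R]_3 -> R) (u0 : 'rV[R]_3 -> 'rV[R]_3) : Prop := {
  NS_velocity_regular : Ck_slab 2 T u ;
  NS_pressure_regular : forall t, 0 < t -> t < T -> Ck_on 1 setT (P t) ;
  NS_momentum : forall t x, 0 < t -> t < T ->
    'D_1 (u ^~ x) t - nu *: laplacian (u t) x
      + advect (u t x) (u t) x + grad (P t) x = 0 ;
  NS_incompressible : forall t x, 0 <= t -> t < T -> divergence (u t) x = 0 ;
  NS_initial : u 0 = u0
}.

(** * Radial symmetry, the exceptional data, and L^2 *)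

Definition radial (R : realType) (f : 'rV[R]_3 -> R) : Prop :=
  exists g : R -> R, forall x, f x = g (enorm x).

Definition exceptional (R : realType) (phi0 psi0 : 'rV[R]_3 -> R) : Prop :=
  exists f0 f2 g0 g2 g4 : R,
    [/\ forall x, phi0 x = f2 * enorm x ^+ 2 + f0,
        forall x, psi0 x = g4 * enorm x ^+ 4 + g2 * enorm x ^+ 2 + g0
      & f2 * g4 = 0].

(* Carried by R * R * R, as the library has no measure on row vectors. *)
Definition lebesgue3 (R : realType) :
    {measure set (measurableTypeR R * measurableTypeR R * measurableTypeR R)
      -> \bar R} :=
  ((@lebesgue_measure R \x @lebesgue_measure R) \x @lebesgue_measure R)%E.

Definition in_L2 (R : realType) (v : 'rV[R]_3 -> 'rV[R]_3) : Prop :=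
  forall i : 'I_3,
    (fun z : measurableTypeR R * measurableTypeR R * measurableTypeR R =>
       v (vec3 z.1.1 z.1.2 z.2) 0 i) \in Lfun (lebesgue3 R) 2%:E.

(* Main.v *)
(* Let [t_n -> 0+] be times at which [phi] and [psi] are radial.  Then [u(t_n)]
   is odd under the reflection [S] in the plane orthogonal to [B], and hence so
   are its Laplacian and, by difference quotients along [t_n], the time
   derivative of [u] at 0.  Adding to the momentum equation its conjugate by [S]
   removes these linear terms and leaves the convection term, which is even at
   time 0; so [(u0 . nabla) u0] is curl-free, as a limit of gradients.

   With [s = |x|^2], radial data [phi0 = f(s)] and [psi0 = g(s)] give
   [u0 = F (A x x) + H (B . x) x - K B], where [F = 2 f'], [G = 2 g'],
   [H = 2 G'] and [K = 2 G + s H].  Curl-freeness on the plane spanned by [A]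
   and [A x B] reads [F F' = 0] and [F H = 2 (K F)'], so [F] is constant; when
   [F = 0], on the plane spanned by [A] and [B] it gives
   [G (7 H' + 2 s H'') = 0].  The only solutions without singularity at [s = 0]
   have [F] and [H] constant with [F H = 0], which is the exceptional case.

   For exceptional data each component of [u0] is a quadratic polynomial in each
   variable, and a square integrable polynomial vanishes. *)

Require Import Defs.
From HB Require Import structures.
From mathcomp Require Import all_boot all_order all_algebra.
From mathcomp Require Import ring lra.
From mathcomp Require Import all_classical all_reals all_analysis.
From mathcomp Require Import measurable_realfun.
Import Order.TTheory GRing.Theory Num.Theory.
Import numFieldNormedType.Exports.
Local Open Scope classical_set_scope.
Local Open Scope ring_scope.

Set Implicit Arguments.
Unset Strict Implicit.
Unset Printing Implicit Defensive.

(** * Directional derivatives *)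

(** Eliminating the pressure by a curl of the full momentum equation would need third derivatives of
    a velocity that is only C^2. The reflection cancels the viscous term before any curl is taken,
    so only first derivatives of the material derivative occur, and that field is C^1. The
    cancellation rests on [A] being orthogonal to [B]: [S] fixes [A], sends [B] to [-B], and
    reverses the sign of cross products, so each of the three terms of a radial field is odd. The
    pressure is constrained only at positive times, with no control as t tends to 0. What passes to
    the limit is the equality of mixed derivatives of a field built from the velocity alone, which
    extends through t = 0. A profile in [s] is known to be regular only for s > 0, since the square
    root is singular at 0. All identities are therefore derived off the origin, where the equations
    also admit H = c s^(-3/2) when F is a nonzero constant, and H = const + c s^(-5/2) when F = 0.
    The regularity of [psi] at the origin enters through a bound on s H(s) near 0, which excludes
    both powers. *)

Lemma is_derive_line (R : realType) (E V : normedModType R) (f : E -> V)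
    (x v : E) (t : R) (d : V) :
  is_derive (t *: v + x) v f d <->
  is_derive t 1 (fun h : R => f (h *: v + x)) d.
Proof.
have -> : is_derive (t *: v + x) v f d = is_derive t 1 (fun h : R => f (h *: v + x)) d.
  apply/propext.
  have H : (fun h : R => h^-1 *: ((f \o shift (t *: v + x)) (h *: v) - f (t *: v + x)))
      = (fun h => h^-1 *: (((fun h => f (h *: v + x)) \o shift t) (h *: 1)
            - f (t *: v + x))).
    by apply/funext => h /=; rewrite [h%:A]mulr1 scalerDl addrA.
  by split=> -[H1 H2]; split;
    rewrite /derivable /derive ?H -?H //; rewrite /derivable /derive ?H -?H in H1 H2.
by [].
Qed.

Lemma is_derive_line0 (R : realType) (E V : normedModType R) (f : E -> V)
    (x v : E) (d : V) :
  is_derive x v f d <-> is_derive (0 : R) 1 (fun h : R => f (h *: v + x)) d.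
Proof.
have := is_derive_line f x v 0 d; rewrite scale0r add0r; exact.
Qed.

Lemma is_derive_chain (R : realType) (E : normedModType R) (f : E -> R)
    (g : R -> R) (x v : E) (df dg : R) :
  is_derive x v f df -> is_derive (f x) 1 g dg ->
  is_derive x v (fun z => g (f z)) (dg * df).
Proof.
move=> hf hg.
apply: (is_derive_line0 _ _ _ _).2.
have H := @is_derive1_comp _ g (fun h => f (h *: v + x)) 0 dg df.
apply: H; first by rewrite scale0r add0r.
exact: (is_derive_line0 _ _ _ _).1.
Qed.

Lemma is_derive_scale (R : realType) (E : normedModType R) (f : E -> R)
    (x v : E) (c d : R) :
  is_derive x v f d -> is_derive x (c *: v) f (c * d).
Proof.
move=> hf; apply: (is_derive_line0 _ _ _ _).2.
have -> : (fun h : R => f (h *: (c *: v) + x)) =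
    (fun h : R => f (h *: v + x)) \o ( *%R^~ c).
  by apply/funext => h /=; rewrite scalerA.
rewrite mulrC; have H := @is_derive1_comp _ (fun h => f (h *: v + x)) ( *%R^~ c) 0 d c.
apply: H.
  by rewrite mul0r; exact: (is_derive_line0 _ _ _ _).1.
have -> : ( *%R^~ c) = c *: (@id R) by apply/funext => h /=; rewrite mulrC.
by apply: is_derive_eq; rewrite [LHS]mulr1.
Qed.

Lemma mvt_dir (R : realType) (E : normedModType R) (f : E -> R) (z v : E) :
  (forall t : R, 0 <= t <= 1 -> derivable f (t *: v + z) v) ->
  exists2 t : R, 0 <= t <= 1 & f (v + z) - f z = 'D_v f (t *: v + z).
Proof.
move=> df.
have dl (t : R) : 0 <= t <= 1 -> is_derive t 1 (fun h : R => f (h *: v + z)) ('D_v f (t *: v + z)).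
  by move=> t01; apply: (is_derive_line _ _ _ _ _).1; apply: derivableP; exact: df.
have [||c] := @MVT_segment R (fun h => f (h *: v + z)) (fun t => 'D_v f (t *: v + z)) 0 1 ler01.
- by move=> t /[!in_itv]/= /andP[t0 t1]; apply: dl; rewrite !ltW.
- apply: derivable_within_continuous => t /[!in_itv]/= t01.
  by have [] := dl _ t01.
- rewrite in_itv/= => c01; rewrite scale1r scale0r add0r subr0 mulr1 => ->.
  by exists c.
Qed.

(** Directional derivatives are homogeneous in the direction but not automatically additive. The
    increment along [v + w] splits into one along [v] from the shifted point [h *: w + x] and one
    along [w] from [x]; the mean value theorem turns the first quotient into a value of ['D_v f]
    near [x]. *)
Lemma is_derive_add_dir (R : realType) (E : normedModType R) (f : E -> R)
    (x v w : E) :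
  (\forall z \near x, derivable f z v) -> {for x, continuous ('D_v f)} ->
  derivable f x w ->
  is_derive x (v + w) f ('D_v f x + 'D_w f x).
Proof.
move=> dv cv dw.
suff H : (fun h : R => h^-1 *: ((f \o shift x) (h *: (v + w)) - f x)) @ 0^'
     --> 'D_v f x + 'D_w f x.
  by split; [apply/cvg_ex; eexists; exact: H|exact/cvg_lim].
have Hw : (fun h : R => h^-1 *: ((f \o shift x) (h *: w) - f x)) @ 0^' --> 'D_w f x.
  by [].
have -> : (fun h : R => h^-1 *: ((f \o shift x) (h *: (v + w)) - f x)) =
   (fun h : R => h^-1 * (f (h *: v + (h *: w + x)) - f (h *: w + x))) +
   (fun h : R => h^-1 *: ((f \o shift x) (h *: w) - f x)).
  apply/funext => h.
  rewrite -[RHS]/(h^-1 * (f (h *: v + (h *: w + x)) - f (h *: w + x)) +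
    h^-1 * (f (h *: w + x) - f x)) -mulrDr addrA subrK /=.
  by rewrite (scalerDr h) -(addrA (h *: v)).
apply: cvgD; last exact: Hw.
apply/cvgrPdist_lt => e e0.
have [d1 /= d10 Hd1] := (nbhs_ballP _ _).1 dv.
have [d2 /= d20 Hd2] := (nbhs_ballP _ _).1 ((cvgrPdist_lt _ _).1 cv e e0).
(* The summand 1 keeps [c] positive even when both directions vanish, so that a radius can be
   divided by it. *)
pose c := `|v| + `|w| + 1.
have c0 : 0 < c by rewrite /c; have := normr_ge0 v; have := normr_ge0 w; lra.
exists (Num.min d1 d2 / c) => /=; first by rewrite divr_gt0// lt_min d10.
move=> h /=; rewrite sub0r normrN ltr_pdivlMr// => hd h0.
have Hb (t : R) : 0 <= t <= 1 -> `|x - (t *: (h *: v) + (h *: w + x))| < Num.min d1 d2.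
  move=> /andP[t0 t1].
  have -> : x - (t *: (h *: v) + (h *: w + x)) = - (h *: (t *: v + w)).
    by rewrite addrA opprD addrCA subrr addr0 scalerDr !scalerA (mulrC h t).
  rewrite normrN normrZ; apply: le_lt_trans hd.
  apply: ler_wpM2l => //; apply: (le_trans (ler_normD _ _)).
  rewrite normrZ (ger0_norm t0) /c.
  have : t * `|v| <= `|v| by exact: ler_piMl.
  have := normr_ge0 w; lra.
have [t t01|t t01 ->] := @mvt_dir R E f (h *: w + x) (h *: v).
  have H : is_derive (t *: (h *: v) + (h *: w + x)) v f ('D_v f (t *: (h *: v) + (h *: w + x))).
    apply/derivableP/Hd1 => /=; rewrite -ball_normE /=.
    by apply: lt_le_trans (Hb _ t01) _; rewrite ge_min lexx.
  by have [] := is_derive_scale h H.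
have H : is_derive (t *: (h *: v) + (h *: w + x)) v f ('D_v f (t *: (h *: v) + (h *: w + x))).
  apply/derivableP/Hd1 => /=; rewrite -ball_normE /=.
  by apply: lt_le_trans (Hb _ t01) _; rewrite ge_min lexx.
have [_ ->] := is_derive_scale h H.
rewrite mulKf //; apply: Hd2; rewrite -ball_normE /=.
by apply: lt_le_trans (Hb _ t01) _; rewrite ge_min lexx orbT.
Qed.

(** The mean value theorem is applied twice: to the increment of [f] along [w], moved in direction
    [v], and then to ['D_v f], moved in direction [w]. *)
Lemma second_difference (R : realType) (E : normedModType R) (f : E -> R)
    (x v w : E) (d h : R) :
  (forall z, `|x - z| < d -> derivable f z v) ->
  (forall z, `|x - z| < d -> derivable ('D_v f) z w) ->
  `|h| * (`|v| + `|w|) < d ->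
  exists2 z, `|x - z| < d &
    f (h *: v + (h *: w + x)) - f (h *: w + x) - (f (h *: v + x) - f x)
    = h * h * 'D_w ('D_v f) z.
Proof.
move=> dv dw hd.
have Hb (s t : R) : 0 <= s <= 1 -> 0 <= t <= 1 ->
    `|x - (s *: (h *: v) + (t *: (h *: w) + x))| < d.
  move=> /andP[s0 s1] /andP[t0 t1].
  have -> : x - (s *: (h *: v) + (t *: (h *: w) + x)) = - (h *: (s *: v + t *: w)).
    by rewrite addrA opprD addrCA subrr addr0 scalerDr !scalerA !(mulrC h).
  rewrite normrN normrZ; apply: le_lt_trans hd.
  apply: ler_wpM2l => //; apply: (le_trans (ler_normD _ _)).
  rewrite !normrZ (ger0_norm t0) (ger0_norm s0); apply: lerD.
    by rewrite ler_piMl.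
  by rewrite ler_piMl.
have z01 : ((0 : R) <= 0) && ((0 : R) <= 1) by rewrite lexx ler01.
have o01 : ((0 : R) <= 1) && ((1 : R) <= 1) by rewrite lexx ler01.
pose g z := f (h *: w + z) - f z.
have dg (s : R) : 0 <= s <= 1 -> is_derive (s *: (h *: v) + x) (h *: v) g
    (h * ('D_v f (s *: (h *: v) + (h *: w + x)) - 'D_v f (s *: (h *: v) + x))).
  move=> s01; apply: is_derive_scale; apply: is_deriveB.
    have H : is_derive (s *: (h *: v) + (h *: w + x)) v f
        ('D_v f (s *: (h *: v) + (h *: w + x))).
      apply/derivableP/dv; have := Hb _ _ s01 o01; by rewrite scale1r.
    apply: (is_derive_line0 _ _ _ _).2; have := (is_derive_line0 _ _ _ _).1 H.
    have -> // : (fun h0 : R => f (h0 *: v + (s *: (h *: v) + (h *: w + x)))) =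
           (fun h0 : R => f (h *: w + (h0 *: v + (s *: (h *: v) + x)))).
    by apply/funext => k; congr f; rewrite [RHS]addrCA; congr (_ + _); rewrite addrCA.
  apply/derivableP/dv; have := Hb _ _ s01 z01; by rewrite scale0r add0r.
have [s s01|s s01] := @mvt_dir R E g x (h *: v).
  by have [] := dg _ s01.
have [_ ->] := dg _ s01.
have dd (t : R) : 0 <= t <= 1 -> is_derive (t *: (h *: w) + (s *: (h *: v) + x))
    (h *: w) ('D_v f) (h * 'D_w ('D_v f) (t *: (h *: w) + (s *: (h *: v) + x))).
  move=> t01; apply: is_derive_scale; apply/derivableP/dw.
  by have := Hb _ _ s01 t01; rewrite addrCA.
have [t t01|t t01] := @mvt_dir R E ('D_v f) (s *: (h *: v) + x) (h *: w).
  by have [] := dd _ t01.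
have [_ ->] := dd _ t01.
rewrite (addrCA (h *: w)) => -> Hg.
exists (t *: (h *: w) + (s *: (h *: v) + x)); first by rewrite addrCA; exact: Hb.
by rewrite -mulrA -Hg /g [h *: w + (h *: v + x)]addrCA; ring.
Qed.

(** Schwarz's theorem. The double difference is unchanged when [v] and [w] are swapped, so the two
    mixed derivatives share a value, taken at two points near [x]; continuity at [x] then compares
    them there. *)
Lemma derive_sym (R : realType) (E : normedModType R) (f : E -> R) (x v w : E) :
  (\forall z \near x, derivable f z v /\ derivable f z w) ->
  (\forall z \near x, derivable ('D_v f) z w /\ derivable ('D_w f) z v) ->
  {for x, continuous ('D_w ('D_v f))} -> {for x, continuous ('D_v ('D_w f))} ->
  'D_w ('D_v f) x = 'D_v ('D_w f) x.
Proof.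
move=> d1 d2 c1 c2; apply/eqP; rewrite -subr_eq0 -normr_le0; apply/ler_addgt0Pr => e e0.
have e20 : 0 < e / 2 by lra.
have [r1 /= r10 H1] := (nbhs_ballP _ _).1 d1.
have [r2 /= r20 H2] := (nbhs_ballP _ _).1 d2.
have [r3 /= r30 H3] := (nbhs_ballP _ _).1 ((cvgrPdist_lt _ _).1 c1 _ e20).
have [r4 /= r40 H4] := (nbhs_ballP _ _).1 ((cvgrPdist_lt _ _).1 c2 _ e20).
rewrite -ball_normE /= in H1 H2 H3 H4.
pose r := Num.min (Num.min r1 r2) (Num.min r3 r4).
have r0 : 0 < r by rewrite /r !lt_min r10 r20 r30 r40.
have rlt z : `|x - z| < r -> [/\ `|x - z| < r1, `|x - z| < r2, `|x - z| < r3 & `|x - z| < r4].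
  by rewrite /r !lt_min => /andP[/andP[-> ->] /andP[-> ->]].
pose c := `|v| + `|w| + 1.
have c0 : 0 < c by rewrite /c; have := normr_ge0 v; have := normr_ge0 w; lra.
pose h := r / (c * 2).
have h0 : 0 < h by rewrite divr_gt0// mulr_gt0.
have hr : `|h| * (`|v| + `|w|) < r.
  rewrite gtr0_norm // /h mulrAC ltr_pdivrMr ?mulr_gt0// ltr_pM2l// /c.
  have := normr_ge0 v; have := normr_ge0 w; lra.
have [z|z|//|z zr Ez] := @second_difference R E f x v w r h.
- by move=> /rlt[/H1[]].
- by move=> /rlt[_ /H2[]].
have [y|y||y yr Ey] := @second_difference R E f x w v r h.
- by move=> /rlt[/H1[]].
- by move=> /rlt[_ /H2[]].
- by rewrite addrC.
have Ezy : 'D_w ('D_v f) z = 'D_v ('D_w f) y.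
  have hh : h * h != 0 by rewrite mulf_neq0// gt_eqF.
  apply: (mulfI hh); apply: (etrans (esym Ez)); apply: etrans Ey.
  rewrite [h *: w + (h *: v + x)]addrCA.
  by move: (f _) (f (h *: w + x)) (f (h *: v + x)) (f x) => p q r' s; ring.
have [_ _ /H3 z3 _] := rlt _ zr; have [_ _ _ /H4 y4] := rlt _ yr.
rewrite Ezy in z3.
rewrite add0r; move: z3 y4.
move: ('D_w ('D_v f) x) ('D_v ('D_w f) x) ('D_v ('D_w f) y) => a b k z3 y4.
have -> : a - b = (a - k) - (b - k) by rewrite opprB addrA subrK.
by apply: (le_trans (ler_normB _ _)); rewrite (splitr e); apply/ltW/ltrD.
Qed.

(** * Vectors of R^3 *)

Lemma sum3E (R : realType) (F : 'I_3 -> R) : \sum_i F i = F 0 + F 1 + F 2%:R.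
Proof.
rewrite !big_ord_recl big_ord0 addr0 addrA.
by congr (F _ + F _ + F _); apply/val_inj.
Qed.

Lemma dotE (R : realType) (x y : 'rV[R]_3) :
  dot x y = x 0 0 * y 0 0 + x 0 1 * y 0 1 + x 0 2%:R * y 0 2%:R.
Proof. by rewrite /dot sum3E. Qed.

Lemma forall_ord3 (Q : 'I_3 -> Prop) : Q 0 -> Q 1 -> Q 2%:R -> forall i, Q i.
Proof.
move=> Q0 Q1 Q2 [[|[|[|//]]] Hi].
- by have -> : Ordinal Hi = 0 by apply/val_inj.
- by have -> : Ordinal Hi = 1 by apply/val_inj.
- by have -> : Ordinal Hi = 2%:R by apply/val_inj.
Qed.

Lemma eq_rV3 (R : realType) (x y : 'rV[R]_3) :
  x 0 0 = y 0 0 -> x 0 1 = y 0 1 -> x 0 2%:R = y 0 2%:R -> x = y.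
Proof.
move=> h0 h1 h2; apply/rowP; exact: forall_ord3.
Qed.

Lemma vec3E (R : realType) (a b c : R) :
  (vec3 a b c 0 0 = a) * (vec3 a b c 0 1 = b) * (vec3 a b c 0 2%:R = c).
Proof. by rewrite /vec3 !mxE. Qed.

Lemma crossE (R : realType) (x y : 'rV[R]_3) :
  (crossprod x y 0 0 = x 0 1 * y 0 2%:R - x 0 2%:R * y 0 1) *
  (crossprod x y 0 1 = x 0 2%:R * y 0 0 - x 0 0 * y 0 2%:R) *
  (crossprod x y 0 2%:R = x 0 0 * y 0 1 - x 0 1 * y 0 0).
Proof. by rewrite /crossprod !vec3E. Qed.

Lemma dotC (R : realType) (x y : 'rV[R]_3) : dot x y = dot y x.
Proof. by rewrite !dotE; ring. Qed.

Lemma dotDl (R : realType) (x y z : 'rV[R]_3) : dot (x + y) z = dot x z + dot y z.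
Proof. by rewrite !dotE !mxE; ring. Qed.

Lemma dotZl (R : realType) (c : R) (x z : 'rV[R]_3) : dot (c *: x) z = c * dot x z.
Proof. by rewrite !dotE !mxE; ring. Qed.

Lemma dotDr (R : realType) (x y z : 'rV[R]_3) : dot z (x + y) = dot z x + dot z y.
Proof. by rewrite !dotE !mxE; ring. Qed.

Lemma dotZr (R : realType) (c : R) (x z : 'rV[R]_3) : dot z (c *: x) = c * dot z x.
Proof. by rewrite !dotE !mxE; ring. Qed.

Lemma dot_delta (R : realType) (x : 'rV[R]_3) i : dot (delta_mx 0 i) x = x 0 i.
Proof.
rewrite /dot (bigD1 i) //= big1 ?addr0 ?mxE ?eqxx ?mul1r // => j ji.
by rewrite mxE eqxx (negbTE ji) mul0r.
Qed.

Lemma dot_eq0 (R : realType) (x : 'rV[R]_3) : (dot x x == 0) = (x == 0).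
Proof.
apply/eqP/eqP => [|->]; last by rewrite dotE !mxE; ring.
rewrite dotE => h; apply: eq_rV3; rewrite !mxE; nra.
Qed.

Lemma dot_ge0 (R : realType) (x : 'rV[R]_3) : 0 <= dot x x.
Proof. rewrite dotE; nra. Qed.

Lemma dot_gt0 (R : realType) (x : 'rV[R]_3) : (0 < dot x x) = (x != 0).
Proof. by rewrite lt_neqAle dot_ge0 andbT eq_sym dot_eq0. Qed.

(** * Functions of class C^k *)

Lemma Ck_on_cont (R : realType) (E V : normedModType R) k (U : set E) (f : E -> V) z :
  Ck_on k U f -> U z -> {for z, continuous f}.
Proof. by case: k => [|k] [H _]; exact: H. Qed.

Lemma Ck_on_derivable (R : realType) (E V : normedModType R) k (U : set E)
  (f : E -> V) z v : Ck_on k.+1 U f -> U z -> derivable f z v.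
Proof. by move=> [_ H] Uz; have [+ _] := H v; exact. Qed.

Lemma Ck_on_derive (R : realType) (E V : normedModType R) k (U : set E)
  (f : E -> V) v : Ck_on k.+1 U f -> Ck_on k U ('D_v f).
Proof. by move=> [_ H]; have [_ +] := H v. Qed.

Lemma Ck_onW (R : realType) (E V : normedModType R) k (U : set E) (f : E -> V) :
  Ck_on k.+1 U f -> Ck_on k U f.
Proof.
elim: k f => [|k IH] f fU.
  by split=> // z; exact: Ck_on_cont fU.
split=> [z|v]; first exact: Ck_on_cont fU.
split=> [z Uz|]; first exact: Ck_on_derivable fU Uz.
exact: IH (Ck_on_derive v fU).
Qed.

Lemma Ck_onWn (R : realType) (E V : normedModType R) k n (U : set E) (f : E -> V) :
  Ck_on (n + k) U f -> Ck_on k U f.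
Proof. by elim: n => // n IH /Ck_onW; exact: IH. Qed.

Lemma near_eq_on (E : topologicalType) (T : Type) (U : set E) (f g : E -> T) z :
  open U -> (forall y, U y -> f y = g y) -> U z -> \forall y \near z, f y = g y.
Proof.
by move=> oU fg Uz; near=> y; apply: fg; near: y; exact: open_nbhs_nbhs.
Unshelve. all: by end_near. Qed.

Lemma near_eq_continuous (E V : topologicalType) (f g : E -> V) z :
  (\forall y \near z, f y = g y) -> {for z, continuous f} -> {for z, continuous g}.
Proof.
move=> fg cf; rewrite /prop_for /continuous_at -(nbhs_singleton fg).
by apply: cvg_trans cf; exact: near_eq_cvg.
Qed.

(** Openness of [U] makes derivatives at its points depend only on the values on [U]; each induction
    on the order below rewrites a derivative by its formula in this way. *)
Lemma eq_Ck_on (R : realType) (E V : normedModType R) k (U : set E) (f g : E -> V) :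
  open U -> (forall z, U z -> f z = g z) -> Ck_on k U f -> Ck_on k U g.
Proof.
move=> oU; elim: k f g => [|k IH] f g fg fU.
  split=> // z Uz; exact: near_eq_continuous (near_eq_on oU fg Uz) (Ck_on_cont fU Uz).
split=> [z Uz|v].
  exact: near_eq_continuous (near_eq_on oU fg Uz) (Ck_on_cont fU Uz).
split=> [z Uz|].
  apply: near_eq_derivable (Ck_on_derivable fU Uz).
  exact: near_eq_on oU fg Uz.
apply: IH (Ck_on_derive v fU) => z Uz.
exact: near_eq_derive (near_eq_on oU fg Uz).
Qed.

Lemma Ck_on_cst (R : realType) (E V : normedModType R) k (U : set E) (c : V) :
  Ck_on k U (fun=> c).
Proof.
elim: k c => [|k IH] c; first by split=> // z _; exact: cvg_cst.
split=> [z _|v]; first exact: cvg_cst.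
split=> [z _|]; first exact: derivable_cst.
have -> : 'D_v (fun=> c) = (fun=> 0) :> (E -> V) by apply/funext => z; exact: derive_cst.
exact: IH.
Qed.

Lemma Ck_onD (R : realType) (E : normedModType R) k (U : set E) (f g : E -> R) :
  open U -> Ck_on k U f -> Ck_on k U g -> Ck_on k U (fun z => f z + g z).
Proof.
move=> oU; elim: k f g => [|k IH] f g fU gU.
  by split=> // z Uz; apply: cvgD; [exact: Ck_on_cont fU _|exact: Ck_on_cont gU _].
split=> [z Uz|v].
  by apply: cvgD; [exact: Ck_on_cont fU _|exact: Ck_on_cont gU _].
split=> [z Uz|].
  by apply: derivableD; [exact: Ck_on_derivable fU _|exact: Ck_on_derivable gU _].
apply: (@eq_Ck_on _ _ _ _ _ (fun z => 'D_v f z + 'D_v g z)) => // [z Uz|].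
  by rewrite -deriveD//; [exact: Ck_on_derivable fU _|exact: Ck_on_derivable gU _].
by apply: IH; exact: Ck_on_derive.
Qed.

Lemma Ck_onM (R : realType) (E : normedModType R) k (U : set E) (f g : E -> R) :
  open U -> Ck_on k U f -> Ck_on k U g -> Ck_on k U (fun z => f z * g z).
Proof.
move=> oU; elim: k f g => [|k IH] f g fU gU.
  by split=> // z Uz; apply: cvgM; [exact: Ck_on_cont fU _|exact: Ck_on_cont gU _].
split=> [z Uz|v].
  by apply: cvgM; [exact: Ck_on_cont fU _|exact: Ck_on_cont gU _].
split=> [z Uz|].
  by apply: derivableM; [exact: Ck_on_derivable fU _|exact: Ck_on_derivable gU _].
apply: (@eq_Ck_on _ _ _ _ _ (fun z => f z * 'D_v g z + g z * 'D_v f z)) => // [z Uz|].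
  by rewrite [RHS]deriveM//; [exact: Ck_on_derivable fU _|exact: Ck_on_derivable gU _].
by apply: Ck_onD => //; apply: IH => //; try exact: Ck_onW; exact: Ck_on_derive.
Qed.

Lemma Ck_on_sum (R : realType) (E : normedModType R) k (U : set E) (I : Type)
    (r : seq I) (F : I -> E -> R) :
  open U -> (forall i, Ck_on k U (F i)) -> Ck_on k U (fun z => \sum_(i <- r) F i z).
Proof.
move=> oU FU; elim: r => [|i r IH].
  apply: eq_Ck_on (Ck_on_cst _ _ 0) => // z _; by rewrite big_nil.
by apply: eq_Ck_on (Ck_onD oU (FU i) IH) => // z _; rewrite big_cons.
Qed.

Lemma is_derive_coord (R : realType) (E : normedModType R) (f : E -> 'rV[R]_3)
    (z v : E) (i : 'I_3) :
  derivable f z v -> is_derive z v (fun y => f y 0 i) ('D_v f z 0 i).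
Proof.
move=> df; split; first by have /derivable_mxP := df.
by rewrite derive_mx // mxE.
Qed.

Lemma continuous_coord (R : realType) (E : topologicalType) (f : E -> 'rV[R]_3)
    (z : E) (i : 'I_3) :
  {for z, continuous f} -> {for z, continuous (fun y => f y 0 i)}.
Proof.
move=> cf.
apply: (@continuous_comp _ _ _ f (fun x : 'rV[R]_3 => x 0 i)) => //.
exact: coord_continuous.
Qed.

Lemma Ck_on_coord (R : realType) (E : normedModType R) k (U : set E)
    (f : E -> 'rV[R]_3) (i : 'I_3) :
  open U -> Ck_on k U f -> Ck_on k U (fun z => f z 0 i).
Proof.
move=> oU; elim: k f => [|k IH] f fU.
  by split=> // z Uz; apply: continuous_coord; exact: Ck_on_cont fU _.
split=> [z Uz|v]; first by apply: continuous_coord; exact: Ck_on_cont fU _.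
have dc z : U z -> is_derive z v (fun y => f y 0 i) ('D_v f z 0 i).
  by move=> Uz; exact/is_derive_coord/(Ck_on_derivable fU).
split=> [z /dc[]//|].
apply: eq_Ck_on (IH _ (Ck_on_derive v fU)) => // z /dc[_ ->] //.
Qed.

Lemma is_derive_dot (R : realType) (E : normedModType R) (f : E -> 'rV[R]_3)
    (z v : E) (m : 'rV[R]_3) :
  derivable f z v -> is_derive z v (fun y => dot m (f y)) (dot m ('D_v f z)).
Proof.
move=> df.
have -> : (fun y => dot m (f y)) = \sum_i (m 0 i *: (fun y => f y 0 i)).
  by apply/funext => y; rewrite fct_sumE.
rewrite /dot; apply: is_derive_sum => i; apply: is_deriveZ; exact: is_derive_coord.
Qed.

Lemma Ck_on_dot (R : realType) (E : normedModType R) k (U : set E)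
    (f : E -> 'rV[R]_3) (m : 'rV[R]_3) :
  open U -> Ck_on k U f -> Ck_on k U (fun z => dot m (f z)).
Proof.
move=> oU fU; apply: Ck_on_sum => // i; apply: Ck_onM => //.
  exact: Ck_on_cst.
exact: Ck_on_coord.
Qed.

(** Regularity is joint in time and space, while the equation is written on slices. The quotient of
    a slice along [v] is literally that of [F] along [(0, v)], so derivability and values transfer
    by rewriting. *)
Lemma slice_quotient (R : realType) (E V : normedModType R) (F : R * E -> V)
    (t : R) (v x : E) :
  (fun h : R => h^-1 *: (((fun y => F (t, y)) \o shift x) (h *: v) - F (t, x))) =
  (fun h : R => h^-1 *: ((F \o shift (t, x)) (h *: ((0, v) : R * E)) - F (t, x))).
Proof.
apply/funext => h /=; congr (_ *: (F _ - _)).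
by rewrite -[RHS]/(h * 0 + t, h *: v + x) mulr0 add0r.
Qed.

Lemma derive_slice (R : realType) (E V : normedModType R) (F : R * E -> V)
   (t : R) (v : E) :
  'D_v (fun x => F (t, x)) = (fun x => 'D_((0, v) : R * E) F (t, x)).
Proof. by apply/funext => x; rewrite /derive slice_quotient. Qed.

Lemma derivable_slice (R : realType) (E V : normedModType R) (F : R * E -> V)
   (t : R) (v x : E) :
  derivable F (t, x) ((0, v) : R * E) -> derivable (fun x => F (t, x)) x v.
Proof. by rewrite /derivable slice_quotient. Qed.

Lemma timeslice_quotient (R : realType) (E V : normedModType R) (F : R * E -> V)
    (t : R) (x : E) :
  (fun h : R => h^-1 *: (((fun s => F (s, x)) \o shift t) (h *: 1) - F (t, x))) =
  (fun h : R => h^-1 *: ((F \o shift (t, x)) (h *: ((1, 0) : R * E)) - F (t, x))).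
Proof.
apply/funext => h /=; congr (_ *: (F _ - _)).
by rewrite -[RHS]/(h * 1 + t, h *: 0 + x) scaler0 add0r.
Qed.

Lemma derive_timeslice (R : realType) (E V : normedModType R) (F : R * E -> V)
   (t : R) (x : E) :
  'D_1 (fun s => F (s, x)) t = 'D_((1, 0) : R * E) F (t, x).
Proof. by rewrite /derive timeslice_quotient. Qed.

Lemma derivable_timeslice (R : realType) (E V : normedModType R) (F : R * E -> V)
   (t : R) (x : E) :
  derivable F (t, x) ((1, 0) : R * E) -> derivable (fun s => F (s, x)) t 1.
Proof. by rewrite /derivable timeslice_quotient. Qed.

Lemma Ck_on_slice (R : realType) (E V : normedModType R) k (U : set (R * E))
    (F : R * E -> V) (t : R) :
  Ck_on k U F -> Ck_on k [set x | U (t, x)] (fun x => F (t, x)).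
Proof.
have ct (x : E) : {for x, continuous (fun y : E => (t, y))}.
  exact: (@cvg_pair _ _ _ (nbhs x) (nbhs t) (nbhs x) _ _ _ (cst t) id
    (@cvg_cst _ t _ (nbhs x) _) (@cvg_id _ _)).
elim: k F => [|k IH] F FU.
  split=> // x /= Ux; apply: continuous_comp; first exact: ct.
  exact: Ck_on_cont FU Ux.
split=> [x Ux|v].
  by apply: continuous_comp; [exact: ct|exact: Ck_on_cont FU Ux].
split=> [x Ux|].
  by apply: derivable_slice; exact: Ck_on_derivable FU Ux.
rewrite derive_slice; exact: IH (Ck_on_derive _ FU).
Qed.

Lemma derive_addv (R : realType) (E : normedModType R) (U : set E) (f : E -> R) x v w :
  open U -> Ck_on 1 U f -> U x -> 'D_(v + w) f x = 'D_v f x + 'D_w f x.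
Proof.
move=> oU fU Ux; apply: derive_val; apply: is_derive_add_dir.
- have := open_nbhs_nbhs (conj oU Ux); apply: filterS => z Uz.
  exact: Ck_on_derivable fU Uz.
- exact: Ck_on_cont (Ck_on_derive v fU) Ux.
- exact: Ck_on_derivable fU Ux.
Qed.

Lemma derive_scalev (R : realType) (E : normedModType R) (U : set E) (f : E -> R) x v c :
  Ck_on 1 U f -> U x -> 'D_(c *: v) f x = c * 'D_v f x.
Proof.
move=> fU Ux; apply: derive_val; apply: is_derive_scale; apply: derivableP.
exact: Ck_on_derivable fU Ux.
Qed.

Lemma rV3_decomp (R : realType) (m : 'rV[R]_3) :
  m = m 0 0 *: delta_mx 0 0 + (m 0 1 *: delta_mx 0 1 + m 0 2%:R *: delta_mx 0 2%:R).
Proof. by apply: eq_rV3; rewrite !mxE /=; ring. Qed.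

Lemma derive_grad (R : realType) (U : set 'rV[R]_3) (f : 'rV[R]_3 -> R) m x :
  open U -> Ck_on 1 U f -> U x -> 'D_m f x = dot m (grad f x).
Proof.
move=> oU fU Ux; rewrite {1}(rV3_decomp m) !(derive_addv _ _ oU fU Ux).
by rewrite !(derive_scalev _ _ fU Ux) dotE !mxE addrA.
Qed.

(** * The reflection in the plane orthogonal to B *)

(* The identity for [B = 0], as [2 / 0 = 0]. *)
Definition reflection (R : realType) (B x : 'rV[R]_3) : 'rV[R]_3 :=
  x - (2 / dot B B * dot B x) *: B.

(** Trades the quotient in [reflection] for a constant known only through [c * dot B B = 2], which
    leaves polynomial identities for [ring]. *)
Lemma reflectionE (R : realType) (B : 'rV[R]_3) : B != 0 ->
  exists2 c : R, c * dot B B = 2 & reflection B = fun x => x - (c * dot B x) *: B.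
Proof.
by rewrite -dot_eq0 => b0; exists (2 / dot B B); rewrite ?divfK.
Qed.

Lemma reflection_linear (R : realType) (B x y : 'rV[R]_3) (h : R) :
  reflection B (h *: x + y) = h *: reflection B x + reflection B y.
Proof.
by rewrite /reflection; move: (2 / _) => c; apply: eq_rV3; rewrite !dotE !mxE; ring.
Qed.

Lemma reflectionK (R : realType) (B x : 'rV[R]_3) : B != 0 ->
  reflection B (reflection B x) = x.
Proof.
move=> /reflectionE[c cb ->].
have H (k1 k2 : R) : x - k1 *: B - k2 *: B = x - (k1 + k2) *: B.
  by rewrite -addrA -opprD -scalerDl.
rewrite H.
have -> : dot B (x - (c * dot B x) *: B) = dot B x - c * dot B x * dot B B.
  by rewrite !dotE !mxE; ring.
have -> : c * (dot B x - c * dot B x * dot B B) =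
  c * dot B x - c * dot B B * (c * dot B x) by ring.
rewrite cb; have -> : c * dot B x + (c * dot B x - 2 * (c * dot B x)) = 0 by ring.
by rewrite scale0r subr0.
Qed.

Lemma reflection0 (R : realType) (B : 'rV[R]_3) : reflection B 0 = 0.
Proof.
by rewrite /reflection; move: (2 / _) => c; apply: eq_rV3; rewrite !dotE !mxE; ring.
Qed.

Lemma reflection_eq0 (R : realType) (B x : 'rV[R]_3) : B != 0 ->
  (reflection B x == 0) = (x == 0).
Proof.
move=> B0; apply/eqP/eqP => [rx|->]; last exact: reflection0.
by rewrite -(reflectionK x B0) rx reflection0.
Qed.

Lemma dot_reflectionl (R : realType) (B x y : 'rV[R]_3) :
  dot (reflection B x) y = dot x (reflection B y).
Proof. by rewrite /reflection; move: (2 / _) => c; rewrite !dotE !mxE; ring. Qed.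

Lemma dot_reflection (R : realType) (B x y : 'rV[R]_3) : B != 0 ->
  dot (reflection B x) (reflection B y) = dot x y.
Proof. by move=> B0; rewrite dot_reflectionl reflectionK. Qed.

Lemma dot_continuous (R : realType) (m : 'rV[R]_3) : continuous (dot m).
Proof.
move=> x; apply: (@Ck_on_cont _ _ _ 0 setT (fun y => dot m (id y))) => //.
by apply: Ck_on_dot; [exact: openT|split=> // z _; exact: cvg_id].
Qed.

Lemma reflection_continuous (R : realType) (B : 'rV[R]_3) : continuous (reflection B).
Proof.
move=> x.
apply: (@continuousB _ _ _ id (fun y => (2 / dot B B * dot B y) *: B)); first exact: cvg_id.
apply: (@continuousZl _ _ _ (fun y => 2 / dot B B * dot B y) B x).
apply: (@continuousM _ _ (cst (2 / dot B B)) (dot B)); first exact: cst_continuous.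
exact: dot_continuous.
Qed.

(** A linear map carries each difference quotient to a difference quotient, so both sides are limits
    of the same function. *)
Lemma derive_comp_linear (R : realType) (E F V : normedModType R) (r : E -> F)
    (f : F -> V) (v : E) :
  (forall (h : R) x y, r (h *: x + y) = h *: r x + r y) ->
  'D_v (f \o r) = 'D_(r v) f \o r.
Proof.
move=> rl; apply/funext => x /=; rewrite /derive.
suff -> : (fun h : R => h^-1 *: (((f \o r) \o shift x) (h *: v) - (f \o r) x)) =
   (fun h : R => h^-1 *: ((f \o shift (r x)) (h *: r v) - f (r x))) by [].
by apply/funext => h /=; rewrite rl.
Qed.

Lemma derivable_comp_linear (R : realType) (E F V : normedModType R) (r : E -> F)
    (f : F -> V) (v x : E) :
  (forall (h : R) x y, r (h *: x + y) = h *: r x + r y) ->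
  derivable f (r x) (r v) -> derivable (f \o r) x v.
Proof.
move=> rl; rewrite /derivable.
suff -> : (fun h : R => h^-1 *: (((f \o r) \o shift x) (h *: v) - (f \o r) x)) =
   (fun h : R => h^-1 *: ((f \o shift (r x)) (h *: r v) - f (r x))) by [].
by apply/funext => h /=; rewrite rl.
Qed.

Lemma Ck_on_comp_linear (R : realType) (E F V : normedModType R) k (r : E -> F) (f : F -> V) :
  (forall (h : R) x y, r (h *: x + y) = h *: r x + r y) -> continuous r ->
  Ck_on k setT f -> Ck_on k setT (f \o r).
Proof.
move=> rl rc; elim: k f => [|k IH] f fU.
  by split=> // z _; apply: continuous_comp; [exact: rc|exact: Ck_on_cont fU _].
split=> [z _|v]; first by apply: continuous_comp; [exact: rc|exact: Ck_on_cont fU _].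
split=> [z _|].
  by apply: derivable_comp_linear => //; exact: (Ck_on_derivable fU).
rewrite derive_comp_linear //; apply: IH; exact: Ck_on_derive.
Qed.

Lemma derive2_grad (R : realType) (f : 'rV[R]_3 -> R) m x :
  Ck_on 2 setT f ->
  'D_m ('D_m f) x = \sum_l m 0 l * \sum_k m 0 k * partial l (partial k f) x.
Proof.
move=> fU; rewrite (@derive_grad _ setT) //; [|exact: openT|exact: Ck_on_derive].
rewrite /dot; apply: eq_bigr => l _; congr (_ * _); rewrite mxE.
have -> : 'D_m f = \sum_k (m 0 k *: partial k f).
  apply/funext => y; rewrite (@derive_grad _ setT) //; [|exact: openT|exact: Ck_onW].
  by rewrite fct_sumE; apply: eq_bigr => k _; rewrite mxE.
apply: derive_val; apply: is_derive_sum => k; apply: is_deriveZ; apply: derivableP.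
exact: (Ck_on_derivable (Ck_on_derive _ fU)).
Qed.

(** The left side is the trace of [S a S], which is that of [a] because [S] is its own inverse. *)
Lemma reflection_trace (R : realType) (B : 'rV[R]_3) (a : 'I_3 -> 'I_3 -> R) :
  B != 0 ->
  \sum_i \sum_l reflection B (delta_mx 0 i) 0 l *
    (\sum_k reflection B (delta_mx 0 i) 0 k * a l k) = \sum_i a i i.
Proof.
move=> B0; have [c cb ->] := reflectionE B0.
rewrite !sum3E !mxE !(dotC B) !dot_delta /=.
move: cb; rewrite dotE => cb.
apply/eqP; rewrite -subr_eq0; apply/eqP.
(* The excess over the trace, for a matrix [a] that need not be symmetric; its first factor
   [c |B|^2 - 2] is zero. *)
transitivity ((c * (B 0 0 * B 0 0 + B 0 1 * B 0 1 + B 0 2%:R * B 0 2%:R) - 2) * c *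
  \sum_l \sum_k B 0 l * B 0 k * a l k).
  by rewrite !sum3E; ring.
by rewrite cb subrr !mul0r.
Qed.

Lemma laplacian_reflection (R : realType) (B : 'rV[R]_3) (f : 'rV[R]_3 -> R) x :
  B != 0 -> Ck_on 2 setT f ->
  laplacian (f \o reflection B) x = laplacian f (reflection B x).
Proof.
move=> B0 fU.
have H (g : 'rV[R]_3 -> R) v : 'D_v (g \o reflection B) = 'D_(reflection B v) g \o reflection B.
  apply: derive_comp_linear => h y z; exact: reflection_linear.
have E i : partial i (partial i (f \o reflection B)) x =
    'D_(reflection B (delta_mx 0 i)) ('D_(reflection B (delta_mx 0 i)) f) (reflection B x).
  have -> : partial i (f \o reflection B) = 'D_(reflection B (delta_mx 0 i)) f \o reflection B.
    exact: H.
  exact: (congr1 (fun g => g x) (H _ _)).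
pose a l k := partial l (partial k f) (reflection B x).
have E2 i : partial i (partial i (f \o reflection B)) x =
    \sum_l reflection B (delta_mx 0 i) 0 l * \sum_k reflection B (delta_mx 0 i) 0 k * a l k.
  by rewrite E (@derive2_grad _ _ _ _ fU).
apply: etrans (reflection_trace a B0).
by apply: eq_bigr => i _; exact: E2.
Qed.

(** * Limits and derivatives along zeros accumulating at 0 from the right *)

Lemma frequently_zero_lim (R : realType) (f : R -> R) (l : R) :
  f @ 0^' --> l -> (forall e, 0 < e -> exists2 t, 0 < t < e & f t = 0) -> l = 0.
Proof.
move=> fl fz; apply/eqP; rewrite -normr_le0; apply/ler_addgt0Pr => e e0.
rewrite add0r; have [d /= d0 H] := (cvgrPdist_lt _ _).1 fl e e0.
have [t /andP[t0 td] ft] := fz _ d0.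
have := H t; rewrite /= sub0r normrN gtr0_norm // ft subr0 => H'.
by apply/ltW/H' => //; rewrite gt_eqF.
Qed.

Lemma frequently_zero_cont (R : realType) (f : R -> R) :
  {for 0, continuous f} ->
  (forall e, 0 < e -> exists2 t, 0 < t < e & f t = 0) -> f 0 = 0.
Proof. by move=> cf; apply: frequently_zero_lim; exact: cvg_within_filter. Qed.

(** The derivative at 0 is a two-sided limit, which exists for velocities because [Ck_slab] extends
    them to negative times; quotients at positive zeros alone then determine it. *)
Lemma frequently_zero_derive (R : realType) (f : R -> R) :
  derivable f 0 1 -> {for 0, continuous f} ->
  (forall e, 0 < e -> exists2 t, 0 < t < e & f t = 0) -> 'D_1 f 0 = 0.
Proof.
move=> df cf fz; have f0 := frequently_zero_cont cf fz.
apply: (frequently_zero_lim df) => e /fz[t te ft]; exists t => //.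
by rewrite /= addr0 [t%:A]mulr1 ft f0 subrr scaler0.
Qed.

(** * The symmetrized momentum equation *)

Section Equation.
Context (R : realType).
Notation E := 'rV[R]_3.

Definition time_dir : R * E := (1, 0).
Definition space_dir (v : E) : R * E := (0, v).

(** The component along [m] of the material derivative of [U], kept as a function on space-time so
    that its derivatives are continuous jointly and can be followed to time 0. *)
Definition acceleration (U : R * E -> E) (m : E) (z : R * E) : R :=
  'D_time_dir (fun z => dot m (U z)) z +
  \sum_i U z 0 i * 'D_(space_dir (delta_mx 0 i)) (fun z => dot m (U z)) z.

Lemma slab_open (T : R) : open [set z : R * E | z.1 < T].
Proof.
have := @open_comp _ _ (@fst R E) [set x : R | x < T].
apply; last exact: open_lt.
by move=> z _; exact: cvg_fst.
Qed.

Lemma acceleration_Ck (T : R) (U : R * E -> E) (m : E) :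
  Ck_on 2 [set z : R * E | z.1 < T] U ->
  Ck_on 1 [set z : R * E | z.1 < T] (acceleration U m).
Proof.
move=> UU; have oU := @slab_open T.
have Um := Ck_on_dot m oU UU.
apply: Ck_onD => //; first exact: Ck_on_derive.
apply: Ck_on_sum => // i; apply: Ck_onM => //; last exact: Ck_on_derive.
exact/Ck_on_coord/Ck_onW.
Qed.

Lemma dot_sum (m : E) (F : 'I_3 -> E) : dot m (\sum_i F i) = \sum_i dot m (F i).
Proof.
apply: (big_morph (dot m)) => [x y|]; first exact: dotDr.
by rewrite dotE !mxE; ring.
Qed.

Lemma derive_dot (F : normedModType R) (f : F -> E) (z v : F) (m : E) :
  derivable f z v -> 'D_v (fun y => dot m (f y)) z = dot m ('D_v f z).
Proof. by move=> /(is_derive_dot m)/@derive_val. Qed.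

Lemma dot_advect (F : E -> E) (m w x : E) :
  (forall v, derivable F x v) ->
  dot m (advect w F x) = \sum_i w 0 i * 'D_(delta_mx 0 i) (fun y => dot m (F y)) x.
Proof.
move=> dF; rewrite /advect dot_sum; apply: eq_bigr => i _.
by rewrite dotZr; congr (_ * _); apply: esym; exact: derive_dot.
Qed.

Lemma dot_laplacian (F : E -> E) (m x : E) :
  Ck_on 2 setT F ->
  dot m (laplacian F x) = laplacian (fun y => dot m (F y)) x.
Proof.
move=> FU; rewrite /laplacian dot_sum; apply: eq_bigr => i _.
have E1 : partial i (fun y => dot m (F y)) = (fun y => dot m (partial i F y)).
  by apply/funext => y; apply: derive_dot; exact: (Ck_on_derivable FU).
rewrite E1; apply: esym; apply: derive_dot.
exact: (Ck_on_derivable (Ck_on_derive _ FU)).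
Qed.

Lemma momentum_dot (nu T : R) (u : R -> E -> E) (P : R -> E -> R) (U : R * E -> E)
    (t : R) (x m : E) :
  Ck_on 2 [set z : R * E | z.1 < T] U ->
  (forall (t : R) x, 0 <= t -> t < T -> u t x = U (t, x)) ->
  0 < t -> t < T -> Ck_on 1 setT (P t) ->
  'D_1 (u ^~ x) t - nu *: laplacian (u t) x
      + advect (u t x) (u t) x + grad (P t) x = 0 ->
  'D_m (P t) x = - acceleration U m (t, x) + nu * laplacian (fun y => dot m (U (t, y))) x.
Proof.
move=> UU uU t0 tT PU.
have ut : u t = (fun y => U (t, y)) by apply/funext => y; rewrite uU // ltW.
have dUx v : derivable (fun y => U (t, y)) x v.
  by apply: derivable_slice; exact: (Ck_on_derivable UU).
have slU : Ck_on 2 setT (fun y => U (t, y)).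
  have := Ck_on_slice t UU; suff -> : [set x0 : E | [set z : R * E | z.1 < T] (t, x0)] = setT by [].
  by apply/seteqP; split.
(* [u] and its extension [U] agree only for times in [[0, T[]; since [t] is interior, they agree on
   a neighbourhood of [t]. *)
have dut : 'D_1 (u ^~ x) t = 'D_time_dir U (t, x).
  rewrite -derive_timeslice; apply: near_eq_derive.
  near=> s; apply: uU; first apply: ltW; near: s; [exact: lt_nbhsr|exact: lt_nbhsl].
move=> /(congr1 (dot m)); rewrite !dotDr -scaleNr dotZr dut.
rewrite -(@derive_grad _ setT) //; last exact: openT.
rewrite ut dot_advect // dot_laplacian // /acceleration.
rewrite derive_dot; last exact: (Ck_on_derivable UU).
rewrite (_ : dot m 0 = 0); last by rewrite dotE !mxE; ring.
have sl i : 'D_(delta_mx 0 i) (fun y => dot m (U (t, y))) x =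
    'D_(space_dir (delta_mx 0 i)) (fun z => dot m (U z)) (t, x).
  exact: (congr1 (fun g => g x) (derive_slice (fun z => dot m (U z)) t (delta_mx 0 i))).
under eq_bigr do rewrite sl.
move: (dot m _) (laplacian _ _) (\sum_(i < 3) _) ('D_m (P t) x) => a b c d H.
have -> : d = (a + - nu * b + c + d) - (a + c) + nu * b by ring.
rewrite H; ring.
Unshelve. all: by end_near. Qed.

(** Meant for the pressure, of which only C^1 regularity is assumed: its directional derivatives
    coincide on [N] with the C^1 functions [a] and [b], and this is enough for Schwarz's theorem. *)
Lemma derive_sym_on (f a b : E -> R) (N : set E) (x v w : E) :
  open N -> N x ->
  (forall y, N y -> derivable f y v /\ derivable f y w) ->
  (forall y, N y -> 'D_v f y = a y) -> (forall y, N y -> 'D_w f y = b y) ->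
  Ck_on 1 N a -> Ck_on 1 N b -> 'D_w a x = 'D_v b x.
Proof.
move=> oN Nx df fa fb aN bN.
have nN : \forall y \near x, N y by exact: open_nbhs_nbhs.
have eqa y : N y -> 'D_w ('D_v f) y = 'D_w a y.
  by move=> Ny; exact: near_eq_derive (near_eq_on oN fa Ny).
have eqb y : N y -> 'D_v ('D_w f) y = 'D_v b y.
  by move=> Ny; exact: near_eq_derive (near_eq_on oN fb Ny).
apply: (etrans (esym (eqa _ Nx))); apply: etrans (eqb _ Nx); apply: derive_sym.
- by apply: filterS nN => y /df.
- apply: filterS nN => y Ny; split.
    apply: near_eq_derivable (Ck_on_derivable aN Ny).
    by apply: (near_eq_on oN _ Ny) => z Nz; exact: esym (fa z Nz).
  apply: near_eq_derivable (Ck_on_derivable bN Ny).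
  by apply: (near_eq_on oN _ Ny) => z Nz; exact: esym (fb z Nz).
- apply: near_eq_continuous (Ck_on_cont (Ck_on_derive w aN) Nx).
  by apply: (near_eq_on oN _ Nx) => z Nz; exact: esym (eqa z Nz).
- apply: near_eq_continuous (Ck_on_cont (Ck_on_derive v bN) Nx).
  by apply: (near_eq_on oN _ Nx) => z Nz; exact: esym (eqb z Nz).
Qed.

Lemma laplacianN (f : E -> R) x : Ck_on 2 setT f ->
  laplacian (fun y => - f y) x = - laplacian f x.
Proof.
move=> fU; rewrite /laplacian -sumrN; apply: eq_bigr => i _.
have -> : partial i (fun y => - f y) = (fun y => - partial i f y).
  by apply/funext => y; apply: deriveN; exact: (Ck_on_derivable fU).
apply: deriveN; exact: (Ck_on_derivable (Ck_on_derive _ fU)).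
Qed.

Lemma eq_laplacian (f g : E -> R) (N : set E) x :
  open N -> N x -> (forall y, N y -> f y = g y) -> laplacian f x = laplacian g x.
Proof.
move=> oN Nx fg; rewrite /laplacian; apply: eq_bigr => i _.
apply: near_eq_derive; apply: (near_eq_on oN _ Nx) => y Ny.
exact: near_eq_derive (near_eq_on oN fg Ny).
Qed.

Lemma nonzero_open : open [set y : E | y != 0].
Proof.
have -> : [set y : E | y != 0] = ~` [set 0].
  by apply/seteqP; split=> y /eqP.
apply: closed_openC; apply: accessible_closed_set1.
exact: hausdorff_accessible (@norm_hausdorff R E).
Qed.

End Equation.

Lemma slice_Ck (R : realType) (V : normedModType R) (T : R) (k : nat)
    (F : R * 'rV[R]_3 -> V) (t : R) :
  Ck_on k [set z : R * 'rV[R]_3 | z.1 < T] F -> t < T ->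
  Ck_on k setT (fun y => F (t, y)).
Proof.
move=> FT tT; have := Ck_on_slice t FT.
suff -> : [set x | [set z : R * 'rV[R]_3 | z.1 < T] (t, x)] = setT by [].
by apply/seteqP; split.
Qed.

Lemma timeslice_continuous (R : realType) (E V : topologicalType)
    (F : R * E -> V) (t : R) (x : E) :
  {for (t, x), continuous F} -> {for t, continuous (fun s => F (s, x))}.
Proof.
move=> cF; apply: continuous_comp; last exact: cF.
exact: (@cvg_pair _ _ _ (nbhs t) (nbhs t) (nbhs x) _ _ _ id (cst x)
  (@cvg_id _ _) (@cvg_cst _ x _ (nbhs t) _)).
Qed.

Lemma derive_reflection (R : realType) (B : 'rV[R]_3) (f : 'rV[R]_3 -> R) v x :
  'D_v (f \o reflection B) x = 'D_(reflection B v) f (reflection B x).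
Proof.
have rl : forall (h : R) (y z : 'rV[R]_3),
    reflection B (h *: y + z) = h *: reflection B y + reflection B z.
  by move=> h y z; exact: reflection_linear.
exact: (congr1 (fun g => g x) (derive_comp_linear f v rl)).
Qed.

Lemma derivable_reflection (R : realType) (B : 'rV[R]_3) (f : 'rV[R]_3 -> R) v x :
  derivable f (reflection B x) (reflection B v) -> derivable (f \o reflection B) x v.
Proof.
move=> df; apply: (@derivable_comp_linear R _ _ _ (reflection B) f v x _ df) => h y z.
exact: reflection_linear.
Qed.

Lemma Ck_onS (R : realType) (E V : normedModType R) k (U W : set E) (f : E -> V) :
  W `<=` U -> Ck_on k U f -> Ck_on k W f.
Proof.
move=> WU; elim: k f => [|k IH] f fU.
  by split=> // z /WU; exact: Ck_on_cont fU.
split=> [z /WU|v]; first exact: Ck_on_cont fU.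
split=> [z /WU|]; first exact: Ck_on_derivable fU.
exact: IH (Ck_on_derive v fU).
Qed.

Lemma Ck_onN (R : realType) (E : normedModType R) k (U : set E) (f : E -> R) :
  open U -> Ck_on k U f -> Ck_on k U (fun z => - f z).
Proof.
move=> oU fU; apply: (@eq_Ck_on R E R k U (fun z => -1 * f z)) => //.
  by move=> z _; rewrite mulN1r.
by apply: Ck_onM => //; exact: Ck_on_cst.
Qed.

(* The component along [m] of [a + S a S], where [a] is the material derivative
   of [U] and [S] the (self-adjoint) reflection. *)
Definition symmetrized_acceleration (R : realType) (B : 'rV[R]_3)
    (U : R * 'rV[R]_3 -> 'rV[R]_3) (m : 'rV[R]_3) (t : R) (y : 'rV[R]_3) : R :=
  acceleration U m (t, y) +
  acceleration U (reflection B m) (t, reflection B y).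

Lemma symmetrized_acceleration_Ck (R : realType) (T t : R) (B : 'rV[R]_3) U m :
  Ck_on 2 [set z : R * 'rV[R]_3 | z.1 < T] U -> t < T ->
  Ck_on 1 setT (symmetrized_acceleration B U m t).
Proof.
move=> UU tT; apply: Ck_onD; first exact: openT.
  exact: slice_Ck (acceleration_Ck m UU) tT.
apply: (@Ck_on_comp_linear R _ _ _ _ (reflection B)
  (fun y => acceleration U (reflection B m) (t, y))).
- by move=> h y z; exact: reflection_linear.
- exact: reflection_continuous.
- exact: slice_Ck (acceleration_Ck _ UU) tT.
Qed.

Lemma derive_symmetrized_acceleration (R : realType) (T t : R) (B : 'rV[R]_3) U m w x :
  Ck_on 2 [set z : R * 'rV[R]_3 | z.1 < T] U -> t < T ->
  'D_w (symmetrized_acceleration B U m t) x =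
  'D_(space_dir w) (acceleration U m) (t, x) +
  'D_(space_dir (reflection B w)) (acceleration U (reflection B m)) (t, reflection B x).
Proof.
move=> UU tT.
have d1 : derivable (fun y => acceleration U m (t, y)) x w.
  exact: (Ck_on_derivable (slice_Ck (acceleration_Ck m UU) tT)).
have d2 : derivable ((fun y => acceleration U (reflection B m) (t, y)) \o reflection B) x w.
  apply: (@derivable_reflection _ B (fun y => acceleration U (reflection B m) (t, y))).
  exact: (Ck_on_derivable (slice_Ck (acceleration_Ck _ UU) tT)).
have -> : symmetrized_acceleration B U m t = (fun y => acceleration U m (t, y)) +
    ((fun y => acceleration U (reflection B m) (t, y)) \o reflection B) by [].
rewrite (deriveD d1 d2) derive_reflection.
have sl n c y : 'D_c (fun y => acceleration U n (t, y)) y =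
    'D_(space_dir c) (acceleration U n) (t, y).
  exact: (congr1 (fun g => g y) (derive_slice (acceleration U n) t c)).
by rewrite !sl.
Qed.

(** By self-adjointness of the reflection the hypothesis says that [dot (reflection B m) (F
    (reflection B y))] is [- dot m (F y)], and the Laplacian commutes with the reflection. The
    origin is excluded because profiles describe the field only away from it. *)
Lemma laplacian_odd (R : realType) (B m : 'rV[R]_3) (F : 'rV[R]_3 -> 'rV[R]_3) x :
  B != 0 -> Ck_on 2 setT F -> x != 0 ->
  (forall y, y != 0 -> F y + reflection B (F (reflection B y)) = 0) ->
  laplacian (fun y => dot m (F y)) x +
  laplacian (fun y => dot (reflection B m) (F y)) (reflection B x) = 0.
Proof.
move=> B0 FU x0 Fodd.
have dF c : Ck_on 2 setT (fun y => dot c (F y)) by apply: Ck_on_dot => //; exact: openT.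
apply/eqP; rewrite addrC addr_eq0; apply/eqP.
apply: (etrans (esym (laplacian_reflection x B0 (dF (reflection B m))))).
apply: (etrans (eq_laplacian (@nonzero_open R) x0 _)); last exact: laplacianN.
move=> y y0 /=; rewrite dot_reflectionl; apply/eqP.
by rewrite -addr_eq0 addrC -dotDr Fodd // dotE !mxE !mulr0 !addr0.
Qed.

(** At a single radial time only the viscous terms cancel. The time derivative stays inside
    [symmetrized_acceleration], since the times around [t] need not be radial. *)
Lemma symmetrized_pressure (R : realType) (nu T t : R) (B : 'rV[R]_3)
    (u : R -> 'rV[R]_3 -> 'rV[R]_3) (P : R -> 'rV[R]_3 -> R)
    (U : R * 'rV[R]_3 -> 'rV[R]_3) (m y : 'rV[R]_3) :
  B != 0 ->
  Ck_on 2 [set z : R * 'rV[R]_3 | z.1 < T] U ->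
  (forall (t : R) x, 0 <= t -> t < T -> u t x = U (t, x)) ->
  0 < t -> t < T -> Ck_on 1 setT (P t) ->
  (forall x, 'D_1 (u ^~ x) t - nu *: laplacian (u t) x
      + advect (u t x) (u t) x + grad (P t) x = 0) ->
  (forall x, x != 0 -> U (t, x) + reflection B (U (t, reflection B x)) = 0) ->
  y != 0 ->
  'D_m (fun y => P t y + P t (reflection B y)) y =
  - symmetrized_acceleration B U m t y.
Proof.
move=> B0 UU uU t0 tT PU mom Uodd y0.
have d1 : derivable (P t) y m by exact: (Ck_on_derivable PU).
have d2 : derivable (P t \o reflection B) y m.
  by apply: (@derivable_reflection _ B (P t)); exact: (Ck_on_derivable PU).
have -> : (fun y => P t y + P t (reflection B y)) = P t + (P t \o reflection B) by [].
rewrite (deriveD d1 d2) derive_reflection.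
rewrite !(momentum_dot _ UU uU t0 tT PU (mom _)) /symmetrized_acceleration.
have := laplacian_odd m B0 (slice_Ck UU tT) y0 Uodd.
move: (acceleration _ _ _) (acceleration _ _ _) (laplacian _ _) (laplacian _ _).
move=> a b c d cd; have -> : d = - c by apply/eqP; rewrite -addr_eq0 cd.
ring.
Qed.

(** At radial times the symmetrized acceleration is minus a gradient off the origin, hence curl-free
    there. For fixed [x] its curl is continuous in time up to and including 0, so vanishing at times
    accumulating at 0 forces vanishing at 0. *)
Lemma symmetrized_curl (R : realType) (nu T : R) (B : 'rV[R]_3)
    (u : R -> 'rV[R]_3 -> 'rV[R]_3) (P : R -> 'rV[R]_3 -> R)
    (U : R * 'rV[R]_3 -> 'rV[R]_3) (x v w : 'rV[R]_3) :
  B != 0 -> 0 < T ->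
  Ck_on 2 [set z : R * 'rV[R]_3 | z.1 < T] U ->
  (forall (t : R) x, 0 <= t -> t < T -> u t x = U (t, x)) ->
  (forall t, 0 < t -> t < T -> Ck_on 1 setT (P t)) ->
  (forall t x, 0 < t -> t < T -> 'D_1 (u ^~ x) t - nu *: laplacian (u t) x
      + advect (u t x) (u t) x + grad (P t) x = 0) ->
  (forall e : R, 0 < e -> exists2 t : R, 0 < t < e &
     forall x, x != 0 -> U (t, x) + reflection B (U (t, reflection B x)) = 0) ->
  x != 0 ->
  'D_w (symmetrized_acceleration B U v 0) x = 'D_v (symmetrized_acceleration B U w 0) x.
Proof.
move=> B0 T0 UU uU PU mom Uodd x0.
(* The spatial derivative at [x] rewritten through space-time derivatives of [acceleration], where
   continuity in [t] is visible. *)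
pose N (m n : 'rV[R]_3) (t : R) := 'D_(space_dir n) (acceleration U m) (t, x) +
  'D_(space_dir (reflection B n)) (acceleration U (reflection B m)) (t, reflection B x).
have EN t m n : t < T -> 'D_n (symmetrized_acceleration B U m t) x = N m n t.
  by move=> tT; exact: derive_symmetrized_acceleration UU tT.
apply: (etrans (EN 0 v w T0)); apply: (etrans _ (esym (EN 0 w v T0))).
have Nc m n : {for 0, continuous (N m n)}.
  have cD (z : 'rV[R]_3) c n' :
     {for 0, continuous (fun t : R => 'D_(space_dir c) (acceleration U n') (t, z))}.
    apply: (@timeslice_continuous R _ _ ('D_(space_dir c) (acceleration U n'))).
    have H := Ck_on_derive (space_dir c) (acceleration_Ck n' UU).
    have H0 := @Ck_on_cont R _ _ 0 _ _ (0, z) H.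
    exact: H0 T0.
  exact: continuousD (cD _ _ _) (cD _ _ _).
suff : N v w 0 - N w v 0 = 0 by move/eqP; rewrite subr_eq0 => /eqP.
apply: (@frequently_zero_cont _ (fun t => N v w t - N w v t)).
  exact: continuousB (Nc v w) (Nc w v).
move=> e e0; have [|t /andP[t0] te Ut] := Uodd (Num.min e T).
  by rewrite lt_min e0.
move: te; rewrite lt_min => /andP[te tT].
exists t; first by rewrite t0.
apply/eqP; rewrite subr_eq0; apply/eqP.
apply: (etrans (esym (EN t v w tT))); apply: (etrans _ (EN t w v tT)).
have dP y n : derivable (fun y => P t y + P t (reflection B y)) y n.
  apply: derivableD; first exact: (Ck_on_derivable (PU _ t0 tT)).
  apply: (@derivable_reflection _ B (P t)).
  exact: (Ck_on_derivable (PU _ t0 tT)).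
have symm m y : y != 0 -> 'D_m (fun y => P t y + P t (reflection B y)) y =
    - symmetrized_acceleration B U m t y.
  move=> y0; apply: (symmetrized_pressure m B0 UU uU t0 tT (PU _ t0 tT) _ Ut y0).
  by move=> z; exact: mom.
have ZC m : Ck_on 1 setT (symmetrized_acceleration B U m t).
  exact: symmetrized_acceleration_Ck UU tT.
have ZN m : Ck_on 1 [set y : 'rV[R]_3 | y != 0] (fun y => - symmetrized_acceleration B U m t y).
  apply: Ck_onN; first exact: nonzero_open.
  by apply: Ck_onS (ZC m).
have dN m n : 'D_n (fun y => - symmetrized_acceleration B U m t y) x =
    - 'D_n (symmetrized_acceleration B U m t) x.
  apply: deriveN; exact: (Ck_on_derivable (ZC m)).
apply/eqP; rewrite -eqr_opp; apply/eqP.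
apply: (etrans (esym (dN v w))); apply: (etrans _ (dN w v)).
apply: (@derive_sym_on _ _ _ _ _ x v w (@nonzero_open R) x0 _ (symm v) (symm w) (ZN v) (ZN w)).
by move=> y _; split.
Qed.

(** The two time derivatives add up to the derivative at 0 of [dot m (U (s, y)) + dot (reflection B
    m) (U (s, reflection B y))], a function of [s] that vanishes at every radial time. *)
Lemma symmetrized_acceleration0 (R : realType) (T : R) (B : 'rV[R]_3)
    (U : R * 'rV[R]_3 -> 'rV[R]_3) (m y : 'rV[R]_3) :
  0 < T -> Ck_on 2 [set z : R * 'rV[R]_3 | z.1 < T] U ->
  (forall e : R, 0 < e -> exists2 t : R, 0 < t < e &
     forall x, x != 0 -> U (t, x) + reflection B (U (t, reflection B x)) = 0) ->
  y != 0 ->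
  let W x := advect (U (0, x)) (fun x => U (0, x)) x in
  symmetrized_acceleration B U m 0 y =
  dot m (W y) + dot (reflection B m) (W (reflection B y)).
Proof.
move=> T0 UU Uodd y0 W.
have oU := @slab_open R T.
have E n x : acceleration U n (0, x) =
    'D_(time_dir R) (fun z => dot n (U z)) (0, x) + dot n (W x).
  rewrite /acceleration /W dot_advect; last first.
    by move=> v; apply: derivable_slice; exact: (Ck_on_derivable (z := (0, x)) UU T0).
  congr (_ + _); apply: eq_bigr => i _; congr (_ * _).
  exact: (congr1 (fun g => g x)
    (esym (derive_slice (fun z => dot n (U z)) 0 (delta_mx 0 i)))).
rewrite /symmetrized_acceleration !E addrACA -[RHS]add0r; congr (_ + _).
have d n x : derivable (fun s => dot n (U (s, x))) 0 1.
  apply: (@derivable_timeslice _ _ _ (fun z => dot n (U z))).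
  exact: (Ck_on_derivable (z := (0, x)) (Ck_on_dot n oU UU) T0).
have c n x : {for 0, continuous (fun s => dot n (U (s, x)))}.
  apply: (@timeslice_continuous _ _ _ (fun z => dot n (U z))).
  exact: (Ck_on_cont (z := (0, x)) (Ck_on_dot n oU UU) T0).
have ts n x : 'D_(time_dir R) (fun z => dot n (U z)) (0, x) =
    'D_1 (fun s => dot n (U (s, x))) 0.
  by rewrite (derive_timeslice (fun z => dot n (U z))).
rewrite !ts -(deriveD (d _ _) (d _ _)).
apply: frequently_zero_derive.
- exact: derivableD (d _ _) (d _ _).
- exact: continuousD (c _ _) (c _ _).
- move=> e /Uodd[t te Ut]; exists t => //.
  rewrite -[LHS]/(dot m (U (t, y)) + dot (reflection B m) (U (t, reflection B y))).
  by rewrite dot_reflectionl -dotDr Ut // dotE !mxE !mulr0 !addr0.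
Qed.

(** * Velocity fields with radial profiles *)

Lemma is_derive_entry (R : realType) (x v : 'rV[R]_3) i :
  is_derive x v (fun y : 'rV[R]_3 => y 0 i) (v 0 i).
Proof.
have := @is_derive_coord R _ id x v i (@derivable_id _ _ x v).
by rewrite derive_id.
Qed.

Lemma is_derive_dotself (R : realType) (x v : 'rV[R]_3) :
  is_derive x v (fun y => dot y y) (2 * dot x v).
Proof.
have -> : (fun y : 'rV[R]_3 => dot y y) =
    \sum_i ((fun y : 'rV[R]_3 => y 0 i) * (fun y => y 0 i)).
  by apply/funext => y; rewrite fct_sumE.
have H := is_derive_sum (fun i => is_deriveM (is_derive_entry x v i) (is_derive_entry x v i)).
apply: is_derive_eq H _; rewrite /dot mulr_sumr; apply: eq_bigr => i _.
by rewrite -[_ *: _]/(x 0 i * v 0 i); ring.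
Qed.

Lemma dotself_continuous (R : realType) : continuous (fun y : 'rV[R]_3 => dot y y).
Proof.
move=> x; apply: (@Ck_on_cont _ _ _ 0 setT) => //.
apply: Ck_on_sum; first exact: openT.
have C i : Ck_on 0 setT (fun y : 'rV[R]_3 => y 0 i).
  by apply: (@Ck_on_coord _ _ 0 setT id); [exact: openT|split=> // z _; exact: cvg_id].
by move=> i; apply: Ck_onM => //; exact: openT.
Qed.

Lemma is_derive_radial (R : realType) (f : R -> R) (f1 : R) (x v : 'rV[R]_3) :
  is_derive (dot x x) 1 f f1 ->
  is_derive x v (fun y => f (dot y y)) (f1 * (2 * dot x v)).
Proof. move=> df; exact: is_derive_chain (is_derive_dotself x v) df. Qed.

Lemma near_dotself (R : realType) (S : set R) (x : 'rV[R]_3) :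
  open S -> S (dot x x) -> \forall y \near x, S (dot y y).
Proof.
move=> oS Sx; apply: (@dotself_continuous R x S).
exact: open_nbhs_nbhs.
Qed.

Lemma partial_radial (R : realType) (f : R -> R) (f1 : R) (x : 'rV[R]_3) i :
  is_derive (dot x x) 1 f f1 ->
  partial i (fun y => f (dot y y)) x = 2 * f1 * x 0 i.
Proof.
move=> /(is_derive_radial (delta_mx 0 i))[_]; rewrite /partial => ->.
by rewrite dotC dot_delta; ring.
Qed.

Lemma is_derive_partial_radial (R : realType) (S : set R) (f f1 : R -> R) (f2 : R)
    (x : 'rV[R]_3) i k :
  open S -> S (dot x x) -> (forall s, S s -> is_derive s 1 f (f1 s)) ->
  is_derive (dot x x) 1 f1 f2 ->
  is_derive x (delta_mx 0 i) (partial k (fun y => f (dot y y)))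
    (4 * f2 * x 0 i * x 0 k + 2 * f1 (dot x x) * (i == k)%:R).
Proof.
move=> oS Sx df df1.
have nS := near_dotself oS Sx.
apply: (@near_eq_is_derive _ _ _ (fun y => 2 * f1 (dot y y) * y 0 k)).
  by apply: filterS nS => y Sy; rewrite (partial_radial _ (df _ Sy)).
have D1 := is_derive_radial (delta_mx 0 i) df1.
have D := is_deriveM (is_deriveM (is_derive_cst (2 : R) x (delta_mx 0 i)) D1)
  (is_derive_entry x (delta_mx 0 i) k).
apply: is_derive_eq D _.
rewrite scaler0 addr0 mxE eqxx /= dotC dot_delta eq_sym.
rewrite -[_ *: _]/(2 * f1 (dot x x) * (i == k)%:R) addrC; congr (_ + _).
by rewrite -[LHS]/(x 0 k * (2 * (f2 * (2 * x 0 i)))); ring.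
Qed.

(** The coefficient [- 4 g1] of [B] is [2 g1] from the gradient of the radial gradient minus [6 g1]
    from the Laplacian in dimension three. The set [S] is the positive half-line for general radial
    data and the whole line for polynomial data. *)
Lemma symplectic12_radial (R : realType) (S : set R) (f f1 g g1 g2 : R -> R)
    (A B x : 'rV[R]_3) :
  open S -> S (dot x x) ->
  (forall s, S s -> is_derive s 1 f (f1 s)) ->
  (forall s, S s -> is_derive s 1 g (g1 s)) ->
  (forall s, S s -> is_derive s 1 g1 (g2 s)) ->
  symplectic12 A B (fun y => f (dot y y)) (fun y => g (dot y y)) x =
  (2 * f1 (dot x x)) *: crossprod A x + (4 * g2 (dot x x) * dot B x) *: x
  - (4 * g1 (dot x x) + 4 * g2 (dot x x) * dot x x) *: B.
Proof.
move=> oS Sx df dg dg1.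
have gphi : grad (fun y => f (dot y y)) x = (2 * f1 (dot x x)) *: x.
  by apply/rowP => i; rewrite !mxE (partial_radial _ (df _ Sx)).
have H i k := is_derive_partial_radial i k oS Sx dg (dg1 _ Sx).
have dgrad i : derivable (grad (fun y => g (dot y y))) x (delta_mx 0 i).
  apply/derivable_mxP => j k.
  have -> : (fun y => grad (fun z => g (dot z z)) y j k) = partial k (fun y => g (dot y y)).
    by apply/funext => y; rewrite mxE.
  by have [] := H i k.
have Hg i k : partial i (grad (fun y => g (dot y y))) x 0 k =
   4 * g2 (dot x x) * x 0 i * x 0 k + 2 * g1 (dot x x) * (i == k)%:R.
  rewrite /partial derive_mx // mxE.
  have -> : (fun y => grad (fun z => g (dot z z)) y 0 k) = partial k (fun y => g (dot y y)).
    by apply/funext => y; rewrite mxE.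
  by have [] := H i k.
have lap : laplacian (fun y => g (dot y y)) x =
    4 * g2 (dot x x) * dot x x + 6 * g1 (dot x x).
  have Hl i : partial i (partial i (fun y => g (dot y y))) x =
      4 * g2 (dot x x) * x 0 i * x 0 i + 2 * g1 (dot x x).
    by have [_] := H i i; rewrite eqxx mulr1.
  by rewrite /laplacian sum3E !Hl; move: (g2 _) (g1 _) => b c; rewrite dotE; ring.
have adv : advect B (grad (fun y => g (dot y y))) x =
    (4 * g2 (dot x x) * dot B x) *: x + (2 * g1 (dot x x)) *: B.
  apply/rowP => k; rewrite /advect summxE.
  under eq_bigr do rewrite mxE Hg.
  move: (g2 _) (g1 _) => b c; rewrite sum3E !mxE dotE; move: k.
  by apply: forall_ord3; rewrite /=; ring.
rewrite /symplectic12 /cross_nabla gphi /cross_nabla_nabla adv lap.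
move: (dot B x) (dot x x) (g2 _) (g1 _) (f1 _) => e d a b c.
by apply: eq_rV3; rewrite !(crossE, mxE); ring.
Qed.

Definition radial_field (R : realType) (A B : 'rV[R]_3) (F H K : R -> R)
    (x : 'rV[R]_3) : 'rV[R]_3 :=
  F (dot x x) *: crossprod A x + (H (dot x x) * dot B x) *: x - K (dot x x) *: B.

Lemma is_derive_dotl (R : realType) (m x v : 'rV[R]_3) : is_derive x v (dot m) (dot m v).
Proof.
have := is_derive_dot m (@derivable_id _ _ x v); by rewrite derive_id.
Qed.

(** Turns a coordinate of a cross product into a linear functional of [y], which the rule for [dot]
    differentiates. *)
Lemma cross_coord (R : realType) (A y : 'rV[R]_3) k :
  crossprod A y 0 k = dot (crossprod (delta_mx 0 k) A) y.
Proof.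
move: k; apply: forall_ord3; rewrite dotE !crossE !mxE /=; ring.
Qed.

Lemma is_derive_radial_field (R : realType) (A B x v : 'rV[R]_3) (F H K F1 H1 K1 : R -> R) k :
  is_derive (dot x x) 1 F (F1 (dot x x)) ->
  is_derive (dot x x) 1 H (H1 (dot x x)) ->
  is_derive (dot x x) 1 K (K1 (dot x x)) ->
  is_derive x v (fun y => radial_field A B F H K y 0 k)
   (2 * F1 (dot x x) * dot x v * crossprod A x 0 k + F (dot x x) * crossprod A v 0 k +
    2 * H1 (dot x x) * dot x v * dot B x * x 0 k + H (dot x x) * dot B v * x 0 k +
    H (dot x x) * dot B x * v 0 k - 2 * K1 (dot x x) * dot x v * B 0 k).
Proof.
move=> /(is_derive_radial v) dF /(is_derive_radial v) dH /(is_derive_radial v) dK.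
have D1 := is_deriveM dF (is_derive_dotl (crossprod (delta_mx 0 k) A) x v).
have D2 := is_deriveM (is_deriveM dH (is_derive_dotl B x v)) (is_derive_entry x v k).
have D3 := is_deriveM dK (is_derive_cst (B 0 k) x v).
have -> : (fun y => radial_field A B F H K y 0 k) =
   (fun y => F (dot y y)) * dot (crossprod (delta_mx 0 k) A) +
   (fun y => H (dot y y)) * dot B * (fun y => y 0 k) -
   (fun y => K (dot y y)) * cst (B 0 k).
  by apply/funext => y; rewrite /radial_field !(cross_coord, mxE).
apply: is_derive_eq (is_deriveB (is_deriveD D1 D2) D3) _.
rewrite !cross_coord !scaler0 add0r.
rewrite -![_ *: _]/(_ * _) /=.
rewrite -[((fun y => H (dot y y)) * dot B) x]/(H (dot x x) * dot B x).
move: (F _) (H _) (F1 _) (H1 _) (K1 _) => f h f1 h1 c1; ring.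
Qed.

Lemma advect_radial_field (R : realType) (A B x w : 'rV[R]_3) (F H K F1 H1 K1 : R -> R) :
  is_derive (dot x x) 1 F (F1 (dot x x)) ->
  is_derive (dot x x) 1 H (H1 (dot x x)) ->
  is_derive (dot x x) 1 K (K1 (dot x x)) ->
  advect w (radial_field A B F H K) x =
    (2 * F1 (dot x x) * dot x w) *: crossprod A x + F (dot x x) *: crossprod A w +
    (2 * H1 (dot x x) * dot x w * dot B x + H (dot x x) * dot B w) *: x +
    (H (dot x x) * dot B x) *: w - (2 * K1 (dot x x) * dot x w) *: B.
Proof.
move=> dF dH dK; apply/rowP => k; rewrite /advect summxE.
have D v := is_derive_radial_field A B v k dF dH dK.
have dv v : derivable (radial_field A B F H K) x v.
  apply/derivable_mxP => i j; rewrite ord1.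
  by have [] := is_derive_radial_field A B v j dF dH dK.
have E i : partial i (radial_field A B F H K) x 0 k =
    2 * F1 (dot x x) * x 0 i * crossprod A x 0 k +
    F (dot x x) * crossprod A (delta_mx 0 i) 0 k +
    2 * H1 (dot x x) * x 0 i * dot B x * x 0 k + H (dot x x) * B 0 i * x 0 k +
    H (dot x x) * dot B x * (delta_mx 0 i : 'rV[R]_3) 0 k - 2 * K1 (dot x x) * x 0 i * B 0 k.
  rewrite /partial derive_mx // mxE; have [_ ->] := D (delta_mx 0 i).
  by rewrite !(dotC _ (delta_mx 0 i)) !dot_delta.
under eq_bigr do rewrite mxE E.
rewrite sum3E ![in RHS](cross_coord, mxE) !cross_coord.
rewrite !(dotC (crossprod _ _) (delta_mx _ _)) !dot_delta.
move: (F _) (H _) (F1 _) (H1 _) (K1 _) (dot B x) (crossprod _ A) => f h f1 h1 c1 b a.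
rewrite !dotE; move: k {D E}.
by apply: forall_ord3; rewrite !mxE /=; ring.
Qed.

(** The right side of [advect_radial_field] with [w] the field itself, where [F1], [H1], [K1] stand
    for the derivatives of the profiles. Being algebraic in them, it can be differentiated once more
    along lines. *)
Definition self_advection (R : realType) (A B : 'rV[R]_3) (F H K F1 H1 K1 : R -> R)
    (x : 'rV[R]_3) : 'rV[R]_3 :=
  let s := dot x x in let u := radial_field A B F H K x in
  (2 * F1 s * dot x u) *: crossprod A x + F s *: crossprod A u +
  (2 * H1 s * dot x u * dot B x + H s * dot B u) *: x +
  (H s * dot B x) *: u - (2 * K1 s * dot x u) *: B.

(** * Cross product identities and one-variable differentiation rules *)

Lemma crossC (R : realType) (x y : 'rV[R]_3) : crossprod x y = - crossprod y x.
Proof. by apply: eq_rV3; rewrite !(crossE, mxE); ring. Qed.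

Lemma crossDr (R : realType) (x y z : 'rV[R]_3) :
  crossprod x (y + z) = crossprod x y + crossprod x z.
Proof. by apply: eq_rV3; rewrite !(crossE, mxE); ring. Qed.

Lemma crossZr (R : realType) (c : R) (x y : 'rV[R]_3) :
  crossprod x (c *: y) = c *: crossprod x y.
Proof. by apply: eq_rV3; rewrite !(crossE, mxE); ring. Qed.

Lemma crossxx (R : realType) (x : 'rV[R]_3) : crossprod x x = 0.
Proof. by apply: eq_rV3; rewrite !(crossE, mxE); ring. Qed.

Lemma double_cross (R : realType) (x y z : 'rV[R]_3) :
  crossprod x (crossprod y z) = dot x z *: y - dot x y *: z.
Proof. by apply: eq_rV3; rewrite !(crossE, mxE) !dotE; ring. Qed.

Lemma dot_crossl (R : realType) (x y : 'rV[R]_3) : dot x (crossprod x y) = 0.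
Proof. by rewrite dotE !crossE; ring. Qed.

Lemma dot_crossr (R : realType) (x y : 'rV[R]_3) : dot y (crossprod x y) = 0.
Proof. by rewrite dotE !crossE; ring. Qed.

Lemma dot_cross_cross (R : realType) (x y : 'rV[R]_3) :
  dot (crossprod x y) (crossprod x y) = dot x x * dot y y - dot x y ^+ 2.
Proof. by rewrite !dotE !crossE; ring. Qed.

Lemma dotNr (R : realType) (x y : 'rV[R]_3) : dot x (- y) = - dot x y.
Proof. by rewrite !dotE !mxE; ring. Qed.

Lemma is_derive_add1 (R : realType) (f g : R -> R) (z f' g' : R) :
  is_derive z 1 f f' -> is_derive z 1 g g' ->
  is_derive z 1 (fun z => f z + g z) (f' + g').
Proof. by move=> df dg; exact: is_deriveD df dg. Qed.

Lemma is_derive_mul1 (R : realType) (f g : R -> R) (z f' g' : R) :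
  is_derive z 1 f f' -> is_derive z 1 g g' ->
  is_derive z 1 (fun z => f z * g z) (f' * g z + f z * g').
Proof.
move=> df dg; apply: is_derive_eq (is_deriveM df dg) _.
by rewrite -![_ *: _]/(_ * _); ring.
Qed.

Lemma is_derive_cst1 (R : realType) (c z : R) : is_derive z 1 (fun=> c) 0.
Proof. exact: is_derive_cst. Qed.

Lemma is_derive_comp_quad (R : realType) (F : R -> R) (F1 c d z : R) :
  is_derive (c * z ^+ 2 + d) 1 F F1 ->
  is_derive z 1 (fun z => F (c * z ^+ 2 + d)) (F1 * (2 * c * z)).
Proof.
move=> dF.
have D : is_derive z 1 (fun z : R => c * z ^+ 2 + d) (2 * c * z).
  have D := is_deriveD (is_deriveM (is_derive_cst c z 1)
    (is_deriveM (is_derive_id z 1) (is_derive_id z 1))) (is_derive_cst d z 1).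
  apply: is_derive_eq D _; rewrite -![_ *: _]/(_ * _) /=; ring.
exact: is_derive_chain D dF.
Qed.

(** * Curl-free self-advection on two planes *)

(** On this plane [dot B x = 0] and [crossprod A C] is [- a *: B], so the field is parallel to [B]
    and orthogonal to [x]; every term with a differentiated profile drops out. *)
Lemma self_advection_perpB (R : realType) (A B : 'rV[R]_3) (F H K F1 H1 K1 : R -> R)
    (y z : R) : dot A B = 0 ->
  let C := crossprod A B in let a := dot A A in let b := dot B B in
  let s := a * b * z ^+ 2 + a * y ^+ 2 in
  self_advection A B F H K F1 H1 K1 (z *: C + y *: A) =
  - (a * F s * z + K s) *: (F s *: C + (H s * b) *: (z *: C + y *: A)).
Proof.
move=> AB C a b s; rewrite /self_advection; set x := z *: C + y *: A.
have CC : dot C C = a * b by rewrite dot_cross_cross AB expr0n subr0.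
have AC : dot A C = 0 by exact: dot_crossl.
have BC : dot B C = 0 by exact: dot_crossr.
have xx : dot x x = s.
  by rewrite /x !dotDr !dotDl !dotZr !dotZl (dotC C A) CC AC /s -/a; ring.
have Bx : dot B x = 0 by rewrite /x !dotDr !dotZr BC (dotC B) AB; ring.
have AxC : crossprod A C = - (a *: B) by rewrite double_cross AB scale0r sub0r.
have u : radial_field A B F H K x = - (a * F s * z + K s) *: B.
  rewrite /radial_field xx Bx mulr0 scale0r addr0 /x crossDr !crossZr crossxx AxC.
  by rewrite scaler0 addr0; move: (F s) (K s) => f k; apply/rowP => i; rewrite !mxE; ring.
rewrite xx u Bx !dotZr (dotC x B) Bx !mulr0 !scale0r subr0 addr0 crossZr add0r.
rewrite -/b -/C; move: (F s) (K s) (H s) => f k h.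
by apply/rowP => i; rewrite !mxE; ring.
Qed.

Lemma euler_perpB (R : realType) (A B : 'rV[R]_3) (F H K F1 H1 K1 : R -> R) :
  dot A B = 0 -> A != 0 -> B != 0 ->
  (forall s : R, 0 < s -> is_derive s 1 F (F1 s)) ->
  (forall s : R, 0 < s -> is_derive s 1 H (H1 s)) ->
  (forall s : R, 0 < s -> is_derive s 1 K (K1 s)) ->
  (forall (x v w : 'rV[R]_3) d1 d2, x != 0 ->
    is_derive x w (fun y => dot v (self_advection A B F H K F1 H1 K1 y)) d1 ->
    is_derive x v (fun y => dot w (self_advection A B F H K F1 H1 K1 y)) d2 ->
    d1 = d2) ->
  forall s : R, 0 < s ->
  F s * F1 s = 0 /\ F s * H s = 2 * (K1 s * F s + K s * F1 s).
Proof.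
move=> AB A0 B0 dF dH dK curl.
pose C := crossprod A B; pose a := dot A A; pose b := dot B B.
have a0 : 0 < a by rewrite dot_gt0.
have b0 : 0 < b by rewrite dot_gt0.
have ab0 : 0 < a * b by rewrite mulr_gt0.
have CC : dot C C = a * b by rewrite dot_cross_cross AB expr0n subr0.
have AC : dot A C = 0 by exact: dot_crossl.
(* The difference of [D1] and [D2] divided by the common factor [- (a * b * y * a)]. Besides its
   occurrence in [s], the variable [z] enters linearly. *)
have key (y z : R) : y != 0 -> let s := a * b * z ^+ 2 + a * y ^+ 2 in
    F s * H s - 4 * a * F s * F1 s * z - 2 * (K1 s * F s + K s * F1 s) = 0.
  move=> y0 s.
  have s0 : 0 < s.
    have y2 : 0 < y ^+ 2 by rewrite exprn_even_gt0.
    have z2 : 0 <= z ^+ 2 by rewrite exprn_even_ge0.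
    by apply: ltr_wpDl; [apply: mulr_ge0 => //; exact: ltW|exact: mulr_gt0].
  have x0 : z *: C + y *: A != 0.
    rewrite -dot_gt0; suff -> : dot (z *: C + y *: A) (z *: C + y *: A) = s by [].
    by rewrite !dotDr !dotDl !dotZr !dotZl (dotC C A) CC AC -/a /s; ring.
  have D1 : is_derive (z *: C + y *: A) C
      (fun y => dot A (self_advection A B F H K F1 H1 K1 y))
      (- (a * b * y) * ((a * F s + a * z * (F1 s * (2 * (a * b) * z)) +
        K1 s * (2 * (a * b) * z)) * H s +
       (a * F s * z + K s) * (H1 s * (2 * (a * b) * z)))).
    apply: (is_derive_line _ _ _ _ _).2.
    have -> : (fun h : R => dot A (self_advection A B F H K F1 H1 K1 (h *: C + y *: A))) =
      (fun h => (- (a * b * y)) * ((a * h * F (a * b * h ^+ 2 + a * y ^+ 2)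
         + K (a * b * h ^+ 2 + a * y ^+ 2)) * H (a * b * h ^+ 2 + a * y ^+ 2))).
      apply/funext => h; rewrite self_advection_perpB // -/C -/a -/b.
      by rewrite !(dotZr, dotDr) AC -/a; ring.
    have D := is_derive_mul1 (is_derive_cst1 (- (a * b * y)) z) (is_derive_mul1
      (is_derive_add1 (is_derive_mul1 (is_derive_mul1 (is_derive_cst1 a z)
        (is_derive_id z 1)) (is_derive_comp_quad (dF _ s0)))
      (is_derive_comp_quad (dK _ s0))) (is_derive_comp_quad (dH _ s0))).
    by apply: is_derive_eq D _; rewrite -/s; ring.
  have sC : a * y ^+ 2 + a * b * z ^+ 2 = s by rewrite addrC.
  have s0' := s0; rewrite -sC in s0'.
  have D2 : is_derive (z *: C + y *: A) A
      (fun y => dot C (self_advection A B F H K F1 H1 K1 y))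
      (- (a * b) * ((a * z * (F1 s * (2 * a * y)) + K1 s * (2 * a * y)) *
         (F s + b * z * H s) +
       (a * F s * z + K s) * (F1 s * (2 * a * y) + b * z * (H1 s * (2 * a * y))))).
    rewrite [z *: C + _]addrC; apply: (is_derive_line _ _ _ _ _).2.
    have -> : (fun h : R => dot C (self_advection A B F H K F1 H1 K1 (h *: A + z *: C))) =
      (fun h => (- (a * b)) * ((a * z * F (a * h ^+ 2 + a * b * z ^+ 2)
         + K (a * h ^+ 2 + a * b * z ^+ 2)) *
         (F (a * h ^+ 2 + a * b * z ^+ 2) + b * z * H (a * h ^+ 2 + a * b * z ^+ 2)))).
      apply/funext => h; rewrite [h *: A + _]addrC self_advection_perpB // -/C -/a -/b.
      rewrite !(dotZr, dotDr) CC (dotC C A) AC.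
      by rewrite [a * h ^+ 2 + _]addrC; ring.
    have D := is_derive_mul1 (is_derive_cst1 (- (a * b)) y) (is_derive_mul1
      (is_derive_add1 (is_derive_mul1 (is_derive_cst1 (a * z) y) (is_derive_comp_quad (dF _ s0')))
      (is_derive_comp_quad (dK _ s0')))
      (is_derive_add1 (is_derive_comp_quad (dF _ s0')) (is_derive_mul1 (is_derive_cst1 (b * z) y)
        (is_derive_comp_quad (dH _ s0'))))).
    by apply: is_derive_eq D _; rewrite sC; ring.
  have e := curl _ _ _ _ _ x0 D1 D2.
  have n0 : - (a * b * y * a) != 0.
    by rewrite oppr_eq0 !mulf_neq0 // gt_eqF.
  apply: (mulfI n0); rewrite mulr0; move/eqP: e; rewrite -subr_eq0 => /eqP e.
  rewrite -[RHS]e; ring.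
move=> s s0.
(* Each of the two summands of the squared norm is made equal to [s / 2], so both coordinates are
   nonzero. Then [z] and [- z] belong to the same [s], and the part of [key] that is odd in [z] must
   vanish by itself. *)
pose y := Num.sqrt (s / (2 * a)); pose z := Num.sqrt (s / (2 * (a * b))).
have y2 : y ^+ 2 = s / (2 * a) by rewrite sqr_sqrtr // divr_ge0 ?ltW ?mulr_gt0.
have z2 : z ^+ 2 = s / (2 * (a * b)) by rewrite sqr_sqrtr // divr_ge0 ?ltW ?mulr_gt0.
have y0 : y != 0 by rewrite gt_eqF // sqrtr_gt0 divr_gt0 ?mulr_gt0.
have z0 : z != 0 by rewrite gt_eqF // sqrtr_gt0 divr_gt0 ?mulr_gt0.
have sE : a * b * z ^+ 2 + a * y ^+ 2 = s.
  by rewrite y2 z2; field; rewrite !gt_eqF.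
have e1 := key y z y0; have e2 := key y (- z) y0.
rewrite sqrrN in e2; rewrite /= sE in e1 e2.
have e3 : (2 * (4 * a * z)) * (F s * F1 s) = 0 by rewrite -[RHS](subrr 0) -{1}e2 -e1; ring.
have FF1 : F s * F1 s = 0.
  apply/eqP; move/eqP: e3; rewrite mulf_eq0 => /orP[|//].
  by rewrite !mulf_eq0 !pnatr_eq0 /= (gt_eqF a0) (negbTE z0).
split=> //; apply/eqP; rewrite -subr_eq0 -e1.
have -> : 4 * a * F s * F1 s * z = 4 * a * z * (F s * F1 s) by ring.
by rewrite FF1 mulr0 subr0.
Qed.

Lemma self_advection_planeAB (R : realType) (A B : 'rV[R]_3) (F H K F1 H1 K1 : R -> R)
    (y z : R) : dot A B = 0 ->
  let a := dot A A in let b := dot B B in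
  let s := b * y ^+ 2 + a * z ^+ 2 in
  F s = 0 -> F1 s = 0 ->
  self_advection A B F H K F1 H1 K1 (y *: B + z *: A) =
  (b ^+ 2 * y ^+ 2 * (2 * H1 s * (H s * s - K s) + 2 * H s ^+ 2) - b * (H s * K s))
    *: (y *: B + z *: A)
  - (b * y * (H s * K s + 2 * K1 s * (H s * s - K s))) *: B.
Proof.
move=> AB a b s Fs F1s; rewrite /self_advection; set x := y *: B + z *: A.
have xx : dot x x = s.
  by rewrite /x !(dotDr, dotDl, dotZr, dotZl) (dotC B A) AB /s -/a -/b; ring.
have Bx : dot B x = b * y by rewrite /x !(dotDr, dotZr) (dotC B A) AB -/b; ring.
clearbody x.
have u : radial_field A B F H K x = (H s * (b * y)) *: x + (- K s) *: B.
  by rewrite /radial_field xx Fs Bx scale0r add0r scaleNr.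
rewrite xx u Bx !(dotDr, dotZr) xx Fs F1s (dotC x B) Bx -/b.
rewrite mulr0 mul0r !scale0r !add0r.
move: (K s) (H s) (H1 s) (K1 s) => k h h1 k1.
by apply/rowP => i; rewrite !mxE; ring.
Qed.

(** On the plane the convection term is [(b ^+ 2 * y ^+ 2 * E1 + E2) x + b y E3 B] with radial [E1],
    [E2], [E3]. Its curl there is proportional to [E1 - E3'], and the statement is [E1 = E3']
    written out. *)
Lemma euler_planeAB (R : realType) (A B : 'rV[R]_3) (F H K F1 H1 K1 H2 K2 : R -> R) :
  dot A B = 0 -> A != 0 -> B != 0 ->
  (forall s : R, 0 < s -> F s = 0) -> (forall s : R, 0 < s -> F1 s = 0) ->
  (forall s : R, 0 < s -> is_derive s 1 H (H1 s)) ->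
  (forall s : R, 0 < s -> is_derive s 1 K (K1 s)) ->
  (forall s : R, 0 < s -> is_derive s 1 H1 (H2 s)) ->
  (forall s : R, 0 < s -> is_derive s 1 K1 (K2 s)) ->
  (forall (x v w : 'rV[R]_3) d1 d2, x != 0 ->
    is_derive x w (fun y => dot v (self_advection A B F H K F1 H1 K1 y)) d1 ->
    is_derive x v (fun y => dot w (self_advection A B F H K F1 H1 K1 y)) d2 ->
    d1 = d2) ->
  forall s : R, 0 < s ->
  2 * H1 s * (H s * s - K s) + 2 * H s ^+ 2 =
  - (H1 s * K s + H s * K1 s + 2 * (K2 s * (H s * s - K s) +
     K1 s * (H1 s * s + H s - K1 s))).
Proof.
move=> AB A0 B0 F0 F10 dH dK dH1 dK1 curl s s0.
pose a := dot A A; pose b := dot B B.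
have a0 : 0 < a by rewrite dot_gt0.
have b0 : 0 < b by rewrite dot_gt0.
pose E1 (t : R) := 2 * (H1 t * (H t * t + (-1) * K t)) + 2 * (H t * H t).
pose E2 (t : R) := (- b) * (H t * K t).
pose E3 (t : R) := (-1) * (H t * K t + 2 * (K1 t * (H t * t + (-1) * K t))).
have dHK (t : R) (t0 : 0 < t) := is_derive_add1 (is_derive_mul1 (dH t t0) (is_derive_id t 1))
  (is_derive_mul1 (is_derive_cst1 (-1) t) (dK t t0)).
have dHH (t : R) (t0 : 0 < t) := is_derive_mul1 (dH t t0) (dK t t0).
(* Existence suffices for the derivatives of [E1] and [E2]: they enter [D1] and [D2] with equal
   coefficients and cancel. That of [E3] survives and is kept explicitly as [e3]. *)
have [e1 dE1] : exists e1 : R -> R, forall t : R, 0 < t -> is_derive t 1 E1 (e1 t).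
  eexists => t t0; exact: (is_derive_add1 (is_derive_mul1 (is_derive_cst1 2 t)
    (is_derive_mul1 (dH1 t t0) (dHK t t0)))
    (is_derive_mul1 (is_derive_cst1 2 t) (is_derive_mul1 (dH t t0) (dH t t0)))).
have [e2 dE2] : exists e2 : R -> R, forall t : R, 0 < t -> is_derive t 1 E2 (e2 t).
  eexists => t t0; exact: (is_derive_mul1 (is_derive_cst1 (- b) t) (dHH t t0)).
have dE3 := is_derive_mul1 (is_derive_cst1 (-1) s) (is_derive_add1 (dHH s s0)
  (is_derive_mul1 (is_derive_cst1 2 s) (is_derive_mul1 (dK1 s s0) (dHK s s0)))).
set e3 := (X in is_derive s 1 _ X) in dE3.
pose y := Num.sqrt (s / (2 * b)); pose z := Num.sqrt (s / (2 * a)).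
have y2 : y ^+ 2 = s / (2 * b) by rewrite sqr_sqrtr // divr_ge0 ?ltW ?mulr_gt0.
have z2 : z ^+ 2 = s / (2 * a) by rewrite sqr_sqrtr // divr_ge0 ?ltW ?mulr_gt0.
have y0 : y != 0 by rewrite gt_eqF // sqrtr_gt0 divr_gt0 ?mulr_gt0.
have z0 : z != 0 by rewrite gt_eqF // sqrtr_gt0 divr_gt0 ?mulr_gt0.
have sE : b * y ^+ 2 + a * z ^+ 2 = s by rewrite y2 z2; field; rewrite !gt_eqF.
have sE' : a * z ^+ 2 + b * y ^+ 2 = s by rewrite addrC.
have x0 : y *: B + z *: A != 0.
  rewrite -dot_gt0; suff -> : dot (y *: B + z *: A) (y *: B + z *: A) = s by [].
  by rewrite !(dotDr, dotDl, dotZr, dotZl) (dotC B A) AB -/a -/b -sE; ring.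
have pos (p q : R) : q != 0 -> 0 < b * p ^+ 2 + a * q ^+ 2.
  move=> q0; have q2 : 0 < q ^+ 2 by rewrite exprn_even_gt0.
  have p2 : 0 <= p ^+ 2 by rewrite exprn_even_ge0.
  by apply: ltr_wpDl; [apply: mulr_ge0 => //; exact: ltW|exact: mulr_gt0].
have pos' (p q : R) : p != 0 -> 0 < b * p ^+ 2 + a * q ^+ 2.
  move=> p0; have p2 : 0 < p ^+ 2 by rewrite exprn_even_gt0.
  have q2 : 0 <= q ^+ 2 by rewrite exprn_even_ge0.
  by apply: ltr_pwDl; [exact: mulr_gt0|apply: mulr_ge0 => //; exact: ltW].
have W (p q : R) : 0 < b * p ^+ 2 + a * q ^+ 2 ->
  let t := b * p ^+ 2 + a * q ^+ 2 in
  self_advection A B F H K F1 H1 K1 (p *: B + q *: A) =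
  (b ^+ 2 * p ^+ 2 * E1 t + E2 t) *: (p *: B + q *: A) + (b * p * E3 t) *: B.
  move=> t0 t; rewrite self_advection_planeAB ?F0 ?F10 // -/a -/b -/t /E1 /E2 /E3.
  move: (K t) (H t) (H1 t) (K1 t) => k h h1 k1.
  by apply/rowP => i; rewrite !mxE; ring.
have D1 : is_derive (y *: B + z *: A) B
    (fun y => dot A (self_advection A B F H K F1 H1 K1 y))
    (a * z * (2 * b ^+ 2 * y * E1 s + b ^+ 2 * y ^+ 2 * (e1 s * (2 * b * y))
       + e2 s * (2 * b * y))).
  apply: (is_derive_line _ _ _ _ _).2.
  have -> : (fun h : R => dot A (self_advection A B F H K F1 H1 K1 (h *: B + z *: A))) =
      (fun h => (a * z) * (b ^+ 2 * (h * h) * E1 (b * h ^+ 2 + a * z ^+ 2)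
          + E2 (b * h ^+ 2 + a * z ^+ 2))).
    apply/funext => h; rewrite W ?pos //.
    by rewrite !(dotDr, dotZr) AB -/a; ring.
  have E1s : is_derive (b * y ^+ 2 + a * z ^+ 2) 1 E1 (e1 s) by rewrite sE; exact: dE1.
  have E2s : is_derive (b * y ^+ 2 + a * z ^+ 2) 1 E2 (e2 s) by rewrite sE; exact: dE2.
  have D := is_derive_mul1 (is_derive_cst1 (a * z) y) (is_derive_add1
    (is_derive_mul1 (is_derive_mul1 (is_derive_cst1 (b ^+ 2) y)
      (is_derive_mul1 (is_derive_id y 1) (is_derive_id y 1))) (is_derive_comp_quad E1s))
    (is_derive_comp_quad E2s)).
  by apply: is_derive_eq D _; rewrite sE; ring.
have D2 : is_derive (y *: B + z *: A) A
    (fun y => dot B (self_advection A B F H K F1 H1 K1 y))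
    (b * y * (b ^+ 2 * y ^+ 2 * (e1 s * (2 * a * z)) + e2 s * (2 * a * z) +
     b * (e3 * (2 * a * z)))).
  rewrite [y *: B + _]addrC; apply: (is_derive_line _ _ _ _ _).2.
  have -> : (fun h : R => dot B (self_advection A B F H K F1 H1 K1 (h *: A + y *: B))) =
      (fun h => (b * y) * (b ^+ 2 * y ^+ 2 * E1 (a * h ^+ 2 + b * y ^+ 2)
          + E2 (a * h ^+ 2 + b * y ^+ 2) + b * E3 (a * h ^+ 2 + b * y ^+ 2))).
    apply/funext => h; rewrite [h *: A + _]addrC [a * _ + _]addrC W ?pos' //.
    by rewrite !(dotDr, dotZr) (dotC B A) AB -/b; ring.
  have E1s : is_derive (a * z ^+ 2 + b * y ^+ 2) 1 E1 (e1 s) by rewrite sE'; exact: dE1.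
  have E2s : is_derive (a * z ^+ 2 + b * y ^+ 2) 1 E2 (e2 s) by rewrite sE'; exact: dE2.
  have E3s : is_derive (a * z ^+ 2 + b * y ^+ 2) 1 E3 e3 by rewrite sE'; exact: dE3.
  have D := is_derive_mul1 (is_derive_cst1 (b * y) z) (is_derive_add1 (is_derive_add1
    (is_derive_mul1 (is_derive_cst1 (b ^+ 2 * y ^+ 2) z) (is_derive_comp_quad E1s))
    (is_derive_comp_quad E2s))
    (is_derive_mul1 (is_derive_cst1 b z) (is_derive_comp_quad E3s))).
  by apply: is_derive_eq D _; rewrite sE'; ring.
have e := curl _ _ _ _ _ x0 D1 D2.
have n0 : 2 * a * b ^+ 2 * y * z != 0.
  by rewrite !mulf_eq0 ?expf_eq0 pnatr_eq0 (gt_eqF a0) (gt_eqF b0) (negbTE y0) (negbTE z0).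
have {}e : E1 s = e3.
  apply: (mulfI n0); apply/eqP; rewrite -subr_eq0; move/eqP: e; rewrite -subr_eq0 => /eqP e.
  by apply/eqP; rewrite -[RHS]e; ring.
move: e; rewrite /E1 /e3 => e.
rewrite (_ : 2 * H1 s * _ + _ = 2 * (H1 s * (H s * s + -1 * K s)) + 2 * (H s * H s)); last by ring.
by rewrite e; ring.
Qed.

(** * Ordinary differential equations on the half-line *)

Lemma constant_of_derive0 (R : realType) (f : R -> R) :
  (forall s : R, 0 < s -> is_derive s 1 f 0) ->
  forall s t : R, 0 < s -> 0 < t -> f s = f t.
Proof.
move=> df.
have lt_case (s t : R) : 0 < s -> s <= t -> f s = f t.
  move=> s0 st.
  have df' x : x \in `]s, t[%R -> is_derive x 1 f ((fun=> 0) x).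
    by rewrite in_itv /= => /andP[sx _]; apply: df; exact: lt_trans sx.
  have [|c _] := @MVT_segment R f (fun=> 0) s t st df'.
    apply: derivable_within_continuous => x; rewrite in_itv /= => /andP[sx _].
    by have [] := df x (lt_le_trans s0 sx).
  by rewrite mul0r => /eqP; rewrite subr_eq0 => /eqP.
move=> s t s0 t0; have [st|/ltW ts] := leP s t; first exact: lt_case.
by apply: esym; exact: lt_case.
Qed.

Lemma affine_of_derive_cst (R : realType) (f : R -> R) (c : R) :
  (forall s : R, 0 < s -> is_derive s 1 f c) ->
  exists d, forall s : R, 0 < s -> f s = c * s + d.
Proof.
move=> df; exists (f 1 - c) => s s0.
have H : f s + (- c) * s = f 1 + (- c) * 1.
  apply: (@constant_of_derive0 R (fun s => f s + (- c) * s)) => // t t0.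
  have D := is_derive_add1 (df t t0)
    (is_derive_mul1 (is_derive_cst1 (- c) t) (is_derive_id t 1)).
  by apply: is_derive_eq D _; ring.
have -> : f s = (f s + (- c) * s) + c * s by ring.
by rewrite H; ring.
Qed.

Lemma eq_derive_on (R : realType) (O : set R) (f g : R -> R) (s f1 g1 : R) :
  open O -> O s -> (forall t, O t -> f t = g t) ->
  is_derive s 1 f f1 -> is_derive s 1 g g1 -> f1 = g1.
Proof.
move=> oO Os fg [_ <-] [_ <-]; apply: near_eq_derive.
exact: near_eq_on oO fg Os.
Qed.

(** The hypothesis says that the square of [F] is constant: either [F] vanishes nowhere and can be
    divided out, or it vanishes identically. *)
Lemma derive0_of_mul_derive0 (R : realType) (F F1 : R -> R) :
  (forall s : R, 0 < s -> is_derive s 1 F (F1 s)) ->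
  (forall s : R, 0 < s -> F s * F1 s = 0) ->
  forall s : R, 0 < s -> F1 s = 0.
Proof.
move=> dF FF1 s s0.
have sq (t : R) : 0 < t -> F t * F t = F s * F s.
  move=> t0; apply: (@constant_of_derive0 R (fun t => F t * F t)) => // r r0.
  apply: is_derive_eq (is_derive_mul1 (dF r r0) (dF r r0)) _.
  by rewrite (mulrC (F1 r)) FF1 // addr0.
have [Fs|Fs] := eqVneq (F s) 0; last first.
  by apply: (mulfI Fs); rewrite FF1 // mulr0.
apply: (@eq_derive_on _ [set t | 0 < t] F (fun=> 0) s _ _ (@open_gt _ 0) s0 _ (dF _ s0)
  (is_derive_cst1 0 s)) => t t0.
by apply/eqP; have := sq t t0; rewrite Fs mul0r => /eqP; rewrite mulf_eq0 orbb.
Qed.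

(** For small [s] the identity bounds the absolute value of [c] by [s * (C * C)], which tends to
    0. *)
Lemma eq0_of_mul_bounded_sqr (R : realType) (c C d : R) (q : R -> R) :
  0 < d -> (forall s : R, 0 < s -> s < d -> `|q s| <= C) ->
  (forall s : R, 0 < s -> s * (q s * q s) = c) -> c = 0.
Proof.
move=> d0 qC qc.
have C0 : 0 <= C by apply: le_trans (qC (d / 2) _ _); rewrite // ?divr_gt0 // ltr_pdivrMr //; lra.
apply/eqP; rewrite -normr_le0; apply/ler_addgt0Pr => e e0; rewrite add0r.
pose s := Num.min (d / 2) (e / (C * C + 1)).
have CC : 0 < C * C + 1 by rewrite ltr_wpDl ?mulr_ge0.
have s0 : 0 < s by rewrite lt_min !divr_gt0.
have sd : s < d.
  by apply: (@le_lt_trans _ _ (d / 2)); [rewrite ge_min lexx|rewrite ltr_pdivrMr //; lra].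
rewrite -(qc s s0) !normrM (gtr0_norm s0).
have h : s * (`|q s| * `|q s|) <= s * (C * C).
  by apply: ler_wpM2l; [exact: ltW|apply: ler_pM => //; exact: qC].
apply: (le_trans h); apply: (@le_trans _ _ (s * (C * C + 1))).
  by apply: ler_wpM2l; [exact: ltW|lra].
by rewrite -ler_pdivlMr // ge_min lexx orbT.
Qed.

Lemma is_derive_pow1 (R : realType) (n : nat) (z : R) :
  is_derive z 1 (fun z => z ^+ n.+1) (n.+1%:R * z ^+ n).
Proof.
elim: n => [|n IH].
  by rewrite expr0 mulr1; exact: is_derive_id.
have -> : (fun z : R => z ^+ n.+2) = (fun z => z * z ^+ n.+1).
  by apply/funext => y; rewrite exprS.
apply: is_derive_eq (is_derive_mul1 (is_derive_id z 1) IH) _.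
by rewrite -[in RHS]natr1 exprS; ring.
Qed.

(* [s^(2 j + 3) h^2] is constant, and tends to 0 with [s]. *)
Lemma homogeneous_ode_eq0 (R : realType) (j : nat) (h h1 : R -> R) (C d : R) :
  (forall s : R, 0 < s -> is_derive s 1 h (h1 s)) ->
  (forall s : R, 0 < s -> (j.*2 + 3)%:R * h s + 2 * s * h1 s = 0) ->
  0 < d -> (forall s : R, 0 < s -> s < d -> `|s * h s| <= C) ->
  forall s : R, 0 < s -> h s = 0.
Proof.
move=> dh ode d0 hC s s0.
have k3 : (j.*2 + 3)%N = j.*2.+3 by rewrite addn3.
rewrite k3 in ode.
pose c := s ^+ j.*2.+3 * (h s * h s).
have hc (t : R) : 0 < t -> t ^+ j.*2.+3 * (h t * h t) = c.
  move=> t0; apply: (@constant_of_derive0 R (fun t => t ^+ j.*2.+3 * (h t * h t))) => // r r0.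
  apply: is_derive_eq (is_derive_mul1 (is_derive_pow1 j.*2.+2 r)
    (is_derive_mul1 (dh r r0) (dh r r0))) _.
  transitivity (r ^+ j.*2.+2 * h r * (j.*2.+3%:R * h r + 2 * r * h1 r)).
    by rewrite [r ^+ j.*2.+3]exprS; ring.
  by rewrite ode // mulr0.
have c0 : c = 0.
  (* The odd power leaves one factor [t] in front of the square of [t ^+ j * (t * h t)]; restricting
     to [t < 1] keeps [t ^+ j] at most 1. *)
  apply: (@eq0_of_mul_bounded_sqr R c C (Num.min d 1) (fun t => t ^+ j * (t * h t))).
  - by rewrite lt_min d0 /=.
  - move=> t t0; rewrite lt_min => /andP[td t1]; rewrite normrM normrX (gtr0_norm t0).
    apply: le_trans (hC t t0 td); rewrite ler_piMl // exprn_ile1 // ltW //.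
  - move=> t t0; rewrite -(hc t t0) -addnn -!addnS exprD !exprS; ring.
have sn : s ^+ j.*2.+3 != 0 by rewrite expf_neq0 // gt_eqF.
by apply/eqP; move/eqP: c0; rewrite /c mulf_eq0 (negbTE sn) mulf_eq0 orbb.
Qed.

(** For a nonzero constant [F] the second equation becomes [3 H + 2 s H1 = 0]. For [F = 0], the
    factor [7 H1 + 2 s H2] is the derivative of [5 H + 2 s H1], which leads to a first-order
    equation with constant right side. These are the cases [j = 0] and [j = 1] of
    [homogeneous_ode_eq0]. *)
Lemma profile_of_euler (R : realType) (F F1 G H H1 H2 : R -> R) (C d : R) :
  (forall s : R, 0 < s -> is_derive s 1 F (F1 s)) ->
  (forall s : R, 0 < s -> is_derive s 1 G (H s / 2)) ->
  (forall s : R, 0 < s -> is_derive s 1 H (H1 s)) ->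
  (forall s : R, 0 < s -> is_derive s 1 H1 (H2 s)) ->
  (forall s : R, 0 < s -> {for s, continuous H2}) ->
  0 < d -> (forall s : R, 0 < s -> s < d -> `|s * H s| <= C) ->
  (forall s : R, 0 < s -> F s * F1 s = 0) ->
  (forall s : R, 0 < s -> F s * H s =
     2 * ((2 * H s + s * H1 s) * F s + (2 * G s + s * H s) * F1 s)) ->
  ((forall s : R, 0 < s -> F s = 0) ->
     forall s : R, 0 < s -> G s * (7 * H1 s + 2 * s * H2 s) = 0) ->
  exists a b c : R, [/\ forall s : R, 0 < s -> F s = a,
    forall s : R, 0 < s -> H s = b,
    forall s : R, 0 < s -> G s = b / 2 * s + c & a * b = 0].
Proof.
move=> dF dG dH dH1 cH2 d0 HC FF1 FH GM.
have F10 := derive0_of_mul_derive0 dF FF1.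
have FE (s : R) : 0 < s -> F s = F 1.
  move=> s0; apply: (@constant_of_derive0 R F) => // t t0.
  by rewrite -(F10 t t0); exact: dF.
have affG b : (forall s : R, 0 < s -> H s = b) ->
    exists c, forall s : R, 0 < s -> G s = b / 2 * s + c.
  by move=> Hb; apply: affine_of_derive_cst => s s0; rewrite -(Hb s s0); exact: dG.
have [Fz|Fnz] := eqVneq (F 1) 0; last first.
  have H0 (s : R) : 0 < s -> H s = 0.
    apply: (@homogeneous_ode_eq0 R 0 H H1 C d) => // t t0.
    apply: (mulfI Fnz); rewrite mulr0.
    have := FH t t0; rewrite (F10 t t0) FE // => e.
    rewrite -[(_ + 3)%N]/3%N.
    have -> : F 1 * (3%:R * H t + 2 * t * H1 t) =
      2 * ((2 * H t + t * H1 t) * F 1 + (2 * G t + t * H t) * 0) - F 1 * H t by ring.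
    by rewrite -e subrr.
  have [c Gc] := affG 0 H0.
  by exists (F 1), 0, c; split => //; rewrite mulr0.
have {}GM := GM (fun s s0 => etrans (FE s s0) Fz).
pose M1 (s : R) := 7 * H1 s + 2 * s * H2 s.
have dM (s : R) : 0 < s -> is_derive s 1 (fun s => 5 * H s + 2 * (s * H1 s)) (M1 s).
  move=> s0.
  have D := is_derive_add1 (is_derive_mul1 (is_derive_cst1 5 s) (dH s s0))
    (is_derive_mul1 (is_derive_cst1 2 s) (is_derive_mul1 (is_derive_id s 1) (dH1 s s0))).
  by apply: is_derive_eq D _; rewrite /M1; ring.
(* A nonzero value of [M1] persists nearby and forces [G] to vanish there, hence also [H], which is
   twice its derivative, and [H1]. Then [5 H + 2 s H1] vanishes on a neighbourhood, and so does its
   derivative [M1]. *)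
have M10 (s : R) : 0 < s -> M1 s = 0.
  move=> s0; apply/eqP; apply: contraT => Ms.
  have cM1 : {for s, continuous M1}.
    apply: cvgD; apply: cvgM.
    - exact: cvg_cst.
    - by have [/derivable1_diffP/differentiable_continuous] := dH1 s s0.
    - by apply: cvgM; [exact: cvg_cst|exact: cvg_id].
    - exact: cH2.
  have nG : \forall t \near s, 0 < t /\ G t = 0.
    have nM : \forall t \near s, M1 t != 0 by exact: cvgr_neq0 cM1 Ms.
    have np : \forall t \near s, 0 < t by exact: lt_nbhsr.
    near=> t.
    have t0 : 0 < t by near: t.
    have Mt : M1 t != 0 by near: t.
    by split => //; apply/eqP; have /eqP := GM t t0; rewrite mulf_eq0 (negbTE Mt) orbF.
  have [W [oO Os] OG] : exists2 W : set R, open_nbhs s W & W `<=` [set t | 0 < t /\ G t = 0].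
    by move: nG; rewrite /prop_near1 nbhsE.
  have OH t : W t -> H t = 0.
    move=> Ot; have [t0 _] := OG t Ot.
    have Ht2 : H t / 2 = 0.
      exact: eq_derive_on oO Ot (fun r Or => (OG r Or).2) (dG t t0) (is_derive_cst1 0 t).
    by rewrite -[H t](divfK (_ : 2 != 0)) ?pnatr_eq0 // Ht2 mul0r.
  have OH1 t : W t -> H1 t = 0.
    move=> Ot; have [t0 _] := OG t Ot.
    exact: eq_derive_on oO Ot OH (dH t t0) (is_derive_cst1 0 t).
  have fg t : W t -> 5 * H t + 2 * (t * H1 t) = 0.
    by move=> Ot; rewrite (OH t Ot) (OH1 t Ot) !mulr0 addr0.
  by rewrite -(eq_derive_on oO Os fg (dM s s0) (is_derive_cst1 0 s)) eqxx in Ms.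
have [m Mm] : exists m, forall s : R, 0 < s -> 5 * H s + 2 * (s * H1 s) = m.
  exists (5 * H 1 + 2 * (1 * H1 1)) => s s0.
  apply: (@constant_of_derive0 R (fun s => 5 * H s + 2 * (s * H1 s)) _ s 1 s0 ltr01) => t t0.
  by rewrite -(M10 t t0); exact: dM.
(* [m / 5] is the constant solution of [5 H + 2 s H1 = m]; subtracting it makes the equation
   homogeneous, and the bound on [s H] changes by at most [d] times its absolute value. *)
have h0 (s : R) : 0 < s -> H s + (- (m / 5)) = 0.
  apply: (@homogeneous_ode_eq0 R 1 (fun s => H s + (- (m / 5))) H1 (C + d * `|m / 5|) d) => //.
  - move=> t t0; apply: is_derive_eq (is_derive_add1 (dH t t0) (is_derive_cst1 _ t)) _.
    by rewrite addr0.
  - by move=> t t0; rewrite -[(_ + 3)%N]/5%N -(Mm t t0); field.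
  - move=> t t0 td; rewrite mulrDr mulrN; apply: (le_trans (ler_normB _ _)).
    apply: lerD; first exact: HC.
    by rewrite normrM (gtr0_norm t0); apply: ler_wpM2r => //; exact: ltW.
have Hm (s : R) : 0 < s -> H s = m / 5 by move=> /h0 /eqP; rewrite subr_eq0 => /eqP.
have [c Gc] := affG _ Hm.
by exists 0, (m / 5), c; split => // [s s0|]; rewrite ?mul0r // FE.
Unshelve. all: by end_near. Qed.

(** * Radial functions as functions of the squared norm *)

Lemma derive_scale1 (R : realType) (f : R -> R) (s v d : R) :
  is_derive s 1 f d -> is_derive s v f (v * d).
Proof. by move=> /(is_derive_scale v); rewrite [v *: 1]mulr1. Qed.

(** The derivative is a constant times a product of the function with itself, so the induction on
    the order closes. *)
Lemma Ck_on_inv (R : realType) k : Ck_on k [set r : R | 0 < r] (fun r => r^-1).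
Proof.
have oP : open [set r : R | 0 < r] by exact: open_gt.
have dV (r v : R) : 0 < r -> is_derive r v (fun r : R => r^-1) (v * (-1 * (r^-1 * r^-1))).
  move=> r0; apply: derive_scale1.
  have rn0 : r != 0 by rewrite gt_eqF.
  apply: DeriveDef; first exact: (derivableV rn0 (@derivable_id _ _ r 1)).
  rewrite (deriveV rn0 (@derivable_id _ _ r 1)) derive_id.
  by rewrite -[_ *: _]/(_ * _) mulr1 mulN1r -expr2 exprVn.
elim: k => [|k IH].
  by split=> // r r0; apply: inv_continuous; rewrite gt_eqF.
split=> [r r0|v]; first by apply: inv_continuous; rewrite gt_eqF.
split=> [r r0|]; first by have [] := dV r v r0.
apply: (@eq_Ck_on R R R k _ (fun r => v * (-1 * (r^-1 * r^-1)))) => // [r r0|].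
  by have [_ ->] := dV r v r0.
by apply: Ck_onM => //; [exact: Ck_on_cst|apply: Ck_onM => //; [exact: Ck_on_cst|exact: Ck_onM]].
Qed.

(** The derivative is again a composition with the square root, now of [f' r / (2 r)] up to the
    constant [v]; the induction is therefore over all [f]. *)
Lemma Ck_on_sqrt (R : realType) k (f : R -> R) :
  Ck_on k [set r : R | 0 < r] f ->
  Ck_on k [set r : R | 0 < r] (fun s => f (Num.sqrt s)).
Proof.
have oP : open [set r : R | 0 < r] by exact: open_gt.
have cont (g : R -> R) n : Ck_on n [set r : R | 0 < r] g ->
   forall z : R, 0 < z -> {for z, continuous (fun s => g (Num.sqrt s))}.
  move=> gU z z0; apply: continuous_comp; first exact: sqrt_continuous.
  by apply: Ck_on_cont gU _; rewrite /= sqrtr_gt0.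
elim: k f => [|k IH] f fU.
  by split=> // z z0; exact: cont fU z z0.
split=> [z z0|v]; first exact: cont fU z z0.
have D (s : R) : 0 < s -> is_derive s v (fun s => f (Num.sqrt s))
    (v * ('D_1 f (Num.sqrt s) * (2^-1 * (Num.sqrt s)^-1))).
  move=> s0; apply: derive_scale1; rewrite -invfM.
  apply: (@is_derive_chain R R Num.sqrt f s 1); first exact: is_derive1_sqrt.
  by apply: derivableP; apply: (Ck_on_derivable fU); rewrite /= sqrtr_gt0.
split=> [z z0|]; first by have [] := D z z0.
apply: (@eq_Ck_on R R R k _
  (fun s => (fun r => v * ('D_1 f r * (2^-1 * r^-1))) (Num.sqrt s))) => //.
  by move=> z z0; have [_ ->] := D z z0.
apply: (IH (fun r => v * ('D_1 f r * (2^-1 * r^-1)))).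
apply: Ck_onM => //; first exact: Ck_on_cst.
apply: Ck_onM => //; first exact: Ck_on_derive.
by apply: Ck_onM => //; [exact: Ck_on_cst|exact: Ck_on_inv].
Qed.

(** [radial] only asserts some function of the norm, with no regularity. Reading off [f] along the
    first axis gives an explicit one that inherits smoothness for [s > 0]. The variable is the
    squared norm, which is polynomial in the coordinates. *)
Definition radial_profile (R : realType) (f : 'rV[R]_3 -> R) (s : R) : R :=
  f (Num.sqrt s *: delta_mx 0 0).

Lemma radial_profileE (R : realType) (f : 'rV[R]_3 -> R) :
  (forall x y, enorm x = enorm y -> f x = f y) ->
  f = fun y => radial_profile f (dot y y).
Proof.
move=> fr; apply/funext => y; apply: fr; rewrite /enorm; congr Num.sqrt.
rewrite dotZl dotZr dot_delta mxE !eqxx mulr1.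
by rewrite -expr2 sqr_sqrtr // dot_ge0.
Qed.

(** Equality on spheres is a pointwise closed condition, so it passes to the limit of radial times
    directly; the later lemmas take it as hypothesis for this reason. *)
Lemma radial_eq (R : realType) (f : 'rV[R]_3 -> R) :
  radial f -> forall x y, enorm x = enorm y -> f x = f y.
Proof. by move=> [g fg] x y xy; rewrite !fg xy. Qed.

Lemma radial_profile_Ck (R : realType) k (f : 'rV[R]_3 -> R) :
  Ck_on k setT f -> Ck_on k [set s : R | 0 < s] (radial_profile f).
Proof.
move=> fU; apply: (@Ck_on_sqrt R k (fun r => f (r *: delta_mx 0 0))).
apply: (@Ck_onS R R R k setT) => //.
apply: (@Ck_on_comp_linear R R 'rV[R]_3 R k (fun r => r *: delta_mx 0 0) f) => //.
  by move=> h x y; rewrite scalerDl scalerA.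
exact: scalel_continuous.
Qed.

Lemma profile_derive (R : realType) k (f : R -> R) (s : R) :
  Ck_on k.+1 [set s : R | 0 < s] f -> 0 < s -> is_derive s 1 f ('D_1 f s).
Proof. by move=> fU s0; apply: derivableP; exact: (Ck_on_derivable fU). Qed.

Lemma symplectic12_radial_field (R : realType) (A B : 'rV[R]_3) (f g : 'rV[R]_3 -> R) x :
  Ck_on 2 setT f -> Ck_on 3 setT g ->
  (forall x y, enorm x = enorm y -> f x = f y) ->
  (forall x y, enorm x = enorm y -> g x = g y) -> x != 0 ->
  let f1 := 'D_1 (radial_profile f) in
  let g1 := 'D_1 (radial_profile g) in let g2 := 'D_1 g1 in
  symplectic12 A B f g x = radial_field A B (fun s => 2 * f1 s) (fun s => 4 * g2 s)
    (fun s => 4 * g1 s + 4 * g2 s * s) x.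
Proof.
move=> fU gU fr gr x0 f1 g1 g2.
have fC := radial_profile_Ck fU; have gC := radial_profile_Ck gU.
rewrite {1}(radial_profileE fr) {1}(radial_profileE gr).
apply: (@symplectic12_radial R [set s | 0 < s] _ f1 _ g1 g2).
- exact: open_gt.
- by rewrite /= dot_gt0.
- by move=> s s0; exact: profile_derive fC s0.
- by move=> s s0; exact: profile_derive gC s0.
- have gC1 : Ck_on 2 [set s : R | 0 < s] g1 by exact: Ck_on_derive.
  by move=> s s0; exact: profile_derive gC1 s0.
Qed.

(** * Parity of radial fields under the reflection *)

Lemma reflection_self (R : realType) (B : 'rV[R]_3) : B != 0 -> reflection B B = - B.
Proof.
move=> /reflectionE[c cb ->]; rewrite cb.
by apply/rowP => i; rewrite !mxE; ring.
Qed.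

Lemma dot_reflection_self (R : realType) (B x : 'rV[R]_3) : B != 0 ->
  dot B (reflection B x) = - dot B x.
Proof. by move=> B0; rewrite -dot_reflectionl reflection_self // dotC dotNr dotC. Qed.

(** The reflection reverses orientation, hence changes the sign of cross products, and it fixes [A]
    because [A] lies in the mirror plane. *)
Lemma cross_reflection (R : realType) (A B x : 'rV[R]_3) : B != 0 -> dot A B = 0 ->
  crossprod A (reflection B x) = - reflection B (crossprod A x).
Proof.
move=> /reflectionE[c cb ->] AB.
(* Expansion valid for any three vectors; orthogonality removes its last term, and multiplication by
   [c] turns the left factor into 2. *)
have E : dot B B *: crossprod A x =
    dot B (crossprod A x) *: B + dot B x *: crossprod A B + dot A B *: crossprod B x.
  by apply: eq_rV3; rewrite !(crossE, mxE) !dotE !crossE; ring.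
have E2 : 2 *: crossprod A x = (c * dot B (crossprod A x)) *: B + (c * dot B x) *: crossprod A B.
  by rewrite -cb -scalerA E AB scale0r addr0 scalerDr !scalerA.
apply/eqP; rewrite -subr_eq0; apply/eqP.
transitivity (2 *: crossprod A x -
  ((c * dot B (crossprod A x)) *: B + (c * dot B x) *: crossprod A B));
  last by rewrite E2 subrr.
rewrite crossDr crossC; move: (dot B x) (dot B (crossprod A x)) => p q.
by apply: eq_rV3; rewrite !(crossE, mxE); ring.
Qed.

Lemma reflectionD (R : realType) (B x y : 'rV[R]_3) :
  reflection B (x + y) = reflection B x + reflection B y.
Proof. by have := reflection_linear B x y 1; rewrite !scale1r. Qed.

Lemma reflectionZ (R : realType) (B x : 'rV[R]_3) c :
  reflection B (c *: x) = c *: reflection B x.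
Proof. by have := reflection_linear B x 0 c; rewrite !addr0 reflection0 addr0. Qed.

Lemma reflectionN (R : realType) (B x : 'rV[R]_3) : reflection B (- x) = - reflection B x.
Proof. by rewrite -scaleN1r reflectionZ scaleN1r. Qed.

Lemma radial_field_reflection (R : realType) (A B x : 'rV[R]_3) F H K :
  B != 0 -> dot A B = 0 ->
  radial_field A B F H K (reflection B x) = - reflection B (radial_field A B F H K x).
Proof.
move=> B0 AB; rewrite /radial_field dot_reflection // cross_reflection //.
rewrite dot_reflection_self // !(reflectionD, reflectionN, reflectionZ) reflection_self //.
move: (reflection _ _) (reflection _ _) (F _) (H _) (K _) => p q f h k.
by apply/rowP => i; rewrite !mxE; ring.
Qed.

Lemma self_advection_reflection (R : realType) (A B x : 'rV[R]_3) F H K F1 H1 K1 :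
  B != 0 -> dot A B = 0 ->
  self_advection A B F H K F1 H1 K1 (reflection B x) =
  reflection B (self_advection A B F H K F1 H1 K1 x).
Proof.
move=> B0 AB; rewrite /self_advection radial_field_reflection // dot_reflection //.
move: (radial_field A B F H K x) => u.
have crN (y : 'rV[R]_3) : crossprod A (- y) = - crossprod A y.
  by rewrite -scaleN1r crossZr scaleN1r.
rewrite !dotNr dot_reflection // !dot_reflection_self // crN !cross_reflection //.
rewrite !(reflectionD, reflectionN, reflectionZ) reflection_self // !opprK.
move: (reflection B _) (reflection B _) (reflection B _) (reflection B _) => p q r t.
by apply/rowP => i; rewrite !mxE; ring.
Qed.

Lemma frequently_of_not_near (R : realType) (Q : R -> Prop) :
  ~ (\forall t \near 0^'+, ~ Q t) -> forall e : R, 0 < e -> exists2 t, 0 < t < e & Q t.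
Proof.
move=> nQ e e0; apply: contrapT => H; apply: nQ.
near=> t => Qt; apply: H; exists t => //.
by apply/andP; split; near: t; [exact: nbhs_right_gt|exact: nbhs_right_lt].
Unshelve. all: by end_near. Qed.

(** The profiles are determined only for [s > 0]; the value at the origin is recovered by continuity
    along an axis. *)
Lemma eq_at0_of_eq_nonzero (R : realType) (f : 'rV[R]_3 -> R) (p : R -> R) :
  continuous f -> continuous p -> (forall x, x != 0 -> f x = p (dot x x)) ->
  forall x, f x = p (dot x x).
Proof.
move=> cf cp fp x; have [->|/fp//] := eqVneq x 0.
pose e : 'rV[R]_3 := delta_mx 0 0.
have ee (t : R) : dot (t *: e) (t *: e) = t * t.
  by rewrite dotZl dotZr dot_delta mxE !eqxx mulr1.
apply/eqP; rewrite -subr_eq0; apply/eqP.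
rewrite -[X in f X - _](scale0r e) -[X in dot X _](scale0r e) -[X in dot _ X](scale0r e) ee.
apply: (@frequently_zero_cont R (fun t => f (t *: e) - p (t * t))).
  apply: continuousB.
    apply: (@continuous_comp _ _ _ (fun t : R => t *: e) f); first exact: scalel_continuous.
    exact: cf.
  apply: (@continuous_comp _ _ _ (fun t : R => t * t) p); last exact: cp.
  by apply: cvgM; exact: cvg_id.
move=> d d0; exists (d / 2); first by rewrite divr_gt0 //= ltr_pdivrMr //; lra.
rewrite fp ?ee ?subrr // scaler_eq0 gt_eqF ?divr_gt0 //=.
by apply/eqP => /rowP /(_ 0); rewrite !mxE eqxx => /eqP; rewrite oner_eq0.
Qed.

Lemma exceptional_of_profiles (R : realType) (phi0 psi0 : 'rV[R]_3 -> R)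
    (a b c : R) (f g : R -> R) :
  continuous phi0 -> continuous psi0 ->
  (forall x, phi0 x = f (dot x x)) -> (forall x, psi0 x = g (dot x x)) ->
  (forall s : R, 0 < s -> is_derive s 1 f (a / 2)) ->
  (forall s : R, 0 < s -> is_derive s 1 g ((b / 2 * s + c) / 2)) ->
  a * b = 0 -> exceptional phi0 psi0.
Proof.
move=> cphi cpsi phiE psiE df dg ab.
have [f0 fE] := affine_of_derive_cst df.
have [g0 gE] : exists d, forall s : R, 0 < s -> g s + - (b / 8) * (s * s) = c / 2 * s + d.
  apply: affine_of_derive_cst => s s0.
  have D := is_derive_add1 (dg s s0) (is_derive_mul1 (is_derive_cst1 (- (b / 8)) s)
    (is_derive_mul1 (is_derive_id s 1) (is_derive_id s 1))).
  by apply: is_derive_eq D _; field.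
have en2 (x : 'rV[R]_3) : enorm x ^+ 2 = dot x x by rewrite sqr_sqrtr // dot_ge0.
(* From [2 f' = a] and [2 g' = b / 2 * s + c], integrated once in [s], the squared norm; the product
   of the leading coefficients is then [a * b / 16]. *)
exists f0, (a / 2), g0, (c / 2), (b / 8); split.
- move=> x; rewrite en2; apply: (@eq_at0_of_eq_nonzero R phi0 (fun s => a / 2 * s + f0)) => //.
    move=> s; apply: cvgD; last exact: cvg_cst.
    by apply: cvgM; [exact: cvg_cst|exact: cvg_id].
  by move=> y y0; rewrite phiE fE // dot_gt0.
- move=> x; rewrite (_ : enorm x ^+ 4 = dot x x ^+ 2); last by rewrite -en2 -exprM.
  rewrite en2.
  apply: (@eq_at0_of_eq_nonzero R psi0 (fun s => b / 8 * s ^+ 2 + c / 2 * s + g0)) => //.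
    move=> s; apply: cvgD; last exact: cvg_cst.
    apply: cvgD; apply: cvgM; try exact: cvg_cst; last exact: cvg_id.
    exact: exprn_continuous.
  move=> y y0; rewrite psiE.
  have -> : g (dot y y) = (g (dot y y) + - (b / 8) * (dot y y * dot y y)) +
     b / 8 * (dot y y * dot y y) by ring.
  by rewrite gE ?dot_gt0 //; ring.
- rewrite (_ : a / 2 * (b / 8) = a * b / 16); last by field.
  by rewrite ab mul0r.
Qed.

(* On the diagonal of the first two coordinates the mixed second derivative of
   [g (|x|^2)] is [2 s g''(s)]. *)
Lemma radial_second_derivative_bounded (R : realType) (psi : 'rV[R]_3 -> R) (g g1 g2 : R -> R) :
  Ck_on 2 setT psi -> psi = (fun y => g (dot y y)) ->
  (forall s : R, 0 < s -> is_derive s 1 g (g1 s)) ->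
  (forall s : R, 0 < s -> is_derive s 1 g1 (g2 s)) ->
  exists C d : R, 0 < d /\ forall s : R, 0 < s -> s < d -> `|s * (4 * g2 s)| <= C.
Proof.
move=> psiU psiE dg dg1.
pose m := partial 0 (partial 1 psi).
pose e : 'rV[R]_3 := delta_mx 0 0 + delta_mx 0 1.
have cm : {for 0, continuous (fun y : R => m (y *: e))}.
  apply: (@continuous_comp _ _ _ (fun y : R => y *: e) m); first exact: scalel_continuous.
  by apply: (@Ck_on_cont _ _ _ 0 setT) => //; exact/Ck_on_derive/Ck_on_derive.
have [d /= d0 Hd] := (cvgrPdist_lt _ _).1 cm 1 ltr01.
(* The vector [e] has squared length 2, so a radius [d] for the parameter [y] becomes [2 d^2] for
   [s]; the factor 2 in the bound undoes the halving in [m (y *: e) = s * (4 * g2 s) / 2]. *)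
exists (2 * (`|m (0 *: e)| + 1)), (2 * d ^+ 2); split; first by rewrite mulr_gt0 // exprn_gt0.
move=> s s0 sd.
pose y := Num.sqrt (s / 2).
have y2 : y ^+ 2 = s / 2 by rewrite sqr_sqrtr // divr_ge0 // ltW.
have y0 : 0 <= y by exact: sqrtr_ge0.
have yd : y < d.
  by rewrite -(ltr_pXn2r (_ : 0 < 2)%N) ?nnegrE ?(ltW d0) // y2 ltr_pdivrMr // mulrC.
have ee : dot (y *: e) (y *: e) = s.
  rewrite dotZl dotZr /e !(dotDl, dotDr, dot_delta) !mxE /=.
  have -> : y * (y * (1 + 0 + (0 + 1))) = y ^+ 2 * 2 :> R by ring.
  by rewrite y2 divfK.
have me : m (y *: e) = s * (4 * g2 s) / 2.
  have Sx : [set r : R | 0 < r] (dot (y *: e) (y *: e)) by rewrite /= ee.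
  have dd : is_derive (dot (y *: e) (y *: e)) 1 g1 (g2 s) by rewrite ee; exact: dg1.
  have [_ E] := is_derive_partial_radial 0 1 (@open_gt _ 0) Sx dg dd.
  rewrite /m psiE; apply: (etrans E); rewrite /e !mxE /= mulr0 addr0.
  have -> : 4 * g2 s * (y * (1 + 0)) * (y * (0 + 1)) = 4 * g2 s * y ^+ 2 by ring.
  by rewrite y2; field.
have := Hd y; rewrite /= sub0r normrN ger0_norm // => /(_ yd); rewrite me => H.
have -> : s * (4 * g2 s) = 2 * (s * (4 * g2 s) / 2) by field.
rewrite normrM ger0_norm //; apply: ler_wpM2l => //.
rewrite -[X in `|X|](subKr (m (0 *: e))); apply: (le_trans (ler_normB _ _)).
by apply: lerD => //; exact: ltW.
Qed.

(** * Radial times tending to zero *)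

Lemma near_eq_advect (R : realType) (N : set 'rV[R]_3) (f g : 'rV[R]_3 -> 'rV[R]_3) w x :
  open N -> N x -> (forall y, N y -> f y = g y) -> advect w f x = advect w g x.
Proof.
move=> oN Nx fg; rewrite /advect; apply: eq_bigr => i _; congr (_ *: _).
exact: near_eq_derive (near_eq_on oN fg Nx).
Qed.

(** The convection term of a radial field is even, so at time 0 the symmetrized acceleration is
    twice that term and inherits nothing else. Derivatives enter as arbitrary [d1], [d2], so that
    values computed along lines can be supplied. *)
Lemma radial_field_curl (R : realType) (nu T : R) (A B : 'rV[R]_3)
    (u : R -> 'rV[R]_3 -> 'rV[R]_3) (P : R -> 'rV[R]_3 -> R)
    (U : R * 'rV[R]_3 -> 'rV[R]_3) (F H K F1 H1 K1 : R -> R) :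
  B != 0 -> dot A B = 0 -> 0 < T ->
  Ck_on 2 [set z : R * 'rV[R]_3 | z.1 < T] U ->
  (forall (t : R) x, 0 <= t -> t < T -> u t x = U (t, x)) ->
  (forall t, 0 < t -> t < T -> Ck_on 1 setT (P t)) ->
  (forall t x, 0 < t -> t < T -> 'D_1 (u ^~ x) t - nu *: laplacian (u t) x
      + advect (u t x) (u t) x + grad (P t) x = 0) ->
  (forall e : R, 0 < e -> exists2 t : R, 0 < t < e &
     forall x, x != 0 -> U (t, x) + reflection B (U (t, reflection B x)) = 0) ->
  (forall x, x != 0 -> U (0, x) = radial_field A B F H K x) ->
  (forall s : R, 0 < s -> is_derive s 1 F (F1 s)) ->
  (forall s : R, 0 < s -> is_derive s 1 H (H1 s)) ->
  (forall s : R, 0 < s -> is_derive s 1 K (K1 s)) ->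
  forall (x v w : 'rV[R]_3) d1 d2, x != 0 ->
    is_derive x w (fun y => dot v (self_advection A B F H K F1 H1 K1 y)) d1 ->
    is_derive x v (fun y => dot w (self_advection A B F H K F1 H1 K1 y)) d2 ->
    d1 = d2.
Proof.
move=> B0 AB T0 UU uU PU mom Uodd U0 dF dH dK x v w d1 d2 x0 D1 D2.
pose S := self_advection A B F H K F1 H1 K1.
have WE y : y != 0 -> advect (U (0, y)) (fun x => U (0, x)) y = S y.
  move=> y0; rewrite (near_eq_advect _ (@nonzero_open R) y0 U0) U0 //.
  have s0 : 0 < dot y y by rewrite dot_gt0.
  exact: advect_radial_field (dF _ s0) (dH _ s0) (dK _ s0).
have ZE m y : y != 0 -> symmetrized_acceleration B U m 0 y = 2 * dot m (S y).
  move=> y0; rewrite (symmetrized_acceleration0 m T0 UU Uodd y0) !WE ?reflection_eq0 //.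
  by rewrite /S self_advection_reflection // dot_reflection // -/S; ring.
have DZ m n d : is_derive x n (fun y => dot m (S y)) d ->
    'D_n (symmetrized_acceleration B U m 0) x = 2 * d.
  move=> D; apply: (etrans (near_eq_derive _ (near_eq_on (@nonzero_open R) (ZE m) x0))).
  by have [_ E] := is_deriveZ 2 D; exact: E.
have E := symmetrized_curl v w B0 T0 UU uU PU mom Uodd x0.
have n2 : 2 != 0 :> R by rewrite pnatr_eq0.
apply: (mulfI n2).
exact: (etrans (esym (DZ v w d1 D1)) (etrans E (DZ w v d2 D2))).
Qed.

Lemma radial_limit (R : realType) (T : R) (f : R -> 'rV[R]_3 -> R) :
  0 < T -> Ck_slab 5 T f ->
  (forall e : R, 0 < e -> exists2 t : R, 0 < t < e & radial (f t)) ->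
  forall x y, enorm x = enorm y -> f 0 x = f 0 y.
Proof.
move=> T0 [G [GU fG]] fr x y xy.
have c z : {for 0, continuous (fun t => G (t, z))}.
  apply: (@timeslice_continuous R _ _ G).
  by have H := @Ck_on_cont R _ _ 5 _ _ (0, z) GU; exact: H T0.
apply/eqP; rewrite -subr_eq0; apply/eqP; rewrite !fG //.
apply: (@frequently_zero_cont R (fun t => G (t, x) - G (t, y))).
  exact: continuousB (c x) (c y).
move=> e e0; have [|t /andP[t0]] := fr (Num.min e T); first by rewrite lt_min e0.
rewrite lt_min => /andP[te tT] rt; exists t; first by rewrite t0.
by rewrite -!fG ?ltW // (radial_eq rt xy) subrr.
Qed.

Lemma slab_slice (R : realType) (T t : R) k (f : R -> 'rV[R]_3 -> R) :
  Ck_slab k T f -> 0 <= t -> t < T -> Ck_on k setT (f t).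
Proof.
move=> [G [GU fG]] t0 tT.
have -> : f t = fun y => G (t, y) by apply/funext => y; rewrite fG.
exact: slice_Ck GU tT.
Qed.

(** Four derivatives of the profile of [psi 0] occur: two in passing to [H], two more in its
    equation, where the last one must also be continuous. *)
Lemma exceptional_of_radial_times (R : realType) (nu T : R) (A B : 'rV[R]_3)
    (u : R -> 'rV[R]_3 -> 'rV[R]_3) (P : R -> 'rV[R]_3 -> R)
    (u0 : 'rV[R]_3 -> 'rV[R]_3) (phi psi : R -> 'rV[R]_3 -> R) :
  0 < T -> A != 0 -> B != 0 -> dot A B = 0 ->
  NS_solution nu T u P u0 ->
  (forall t x, 0 <= t -> t < T -> u t x = symplectic12 A B (phi t) (psi t) x) ->
  Ck_slab 5 T phi -> Ck_slab 5 T psi ->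
  (forall e : R, 0 < e -> exists2 t, 0 < t < e & radial (phi t) /\ radial (psi t)) ->
  exceptional (phi 0) (psi 0).
Proof.
move=> T0 A0 B0 AB [[U [UU uU]] PU mom _ _] u_rep phiS psiS fr.
have phiC := slab_slice phiS (lexx 0) T0.
have psiC := slab_slice psiS (lexx 0) T0.
have phir : forall x y, enorm x = enorm y -> phi 0 x = phi 0 y.
  by apply: (radial_limit T0 phiS) => e /fr[t te [rt _]]; exists t.
have psir : forall x y, enorm x = enorm y -> psi 0 x = psi 0 y.
  by apply: (radial_limit T0 psiS) => e /fr[t te [_ rt]]; exists t.
have Uodd (e : R) : 0 < e -> exists2 t : R, 0 < t < e &
     forall x, x != 0 -> U (t, x) + reflection B (U (t, reflection B x)) = 0.
  move=> e0; have [|t /andP[t0]] := fr (Num.min e T); first by rewrite lt_min e0.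
  rewrite lt_min => /andP[te tT] [/radial_eq rphi /radial_eq rpsi].
  exists t; first by rewrite t0.
  have phit := slab_slice phiS (ltW t0) tT.
  have psit := slab_slice psiS (ltW t0) tT.
  have E x : x != 0 -> U (t, x) = radial_field A B
     (fun s => 2 * 'D_1 (radial_profile (phi t)) s)
     (fun s => 4 * 'D_1 ('D_1 (radial_profile (psi t))) s)
     (fun s => 4 * 'D_1 (radial_profile (psi t)) s +
       4 * 'D_1 ('D_1 (radial_profile (psi t))) s * s) x.
    move=> x0; rewrite -uU ?ltW // u_rep ?ltW //.
    exact: (symplectic12_radial_field A B (@Ck_onWn _ _ _ 2 3 _ _ phit)
      (@Ck_onWn _ _ _ 3 2 _ _ psit) rphi rpsi x0).
  move=> x x0; rewrite !E ?reflection_eq0 //.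
  by rewrite radial_field_reflection // reflectionN reflectionK // subrr.
pose f := radial_profile (phi 0); pose g := radial_profile (psi 0).
pose f1 : R -> R := 'D_1 f; pose f2 : R -> R := 'D_1 f1.
pose g1 : R -> R := 'D_1 g; pose g2 : R -> R := 'D_1 g1.
pose g3 : R -> R := 'D_1 g2; pose g4 : R -> R := 'D_1 g3.
pose pos := [set s : R | 0 < s].
have fC : Ck_on 5 pos f := radial_profile_Ck phiC.
have gC : Ck_on 5 pos g := radial_profile_Ck psiC.
have f1C : Ck_on 4 pos f1 := Ck_on_derive (1 : R) fC.
have g1C : Ck_on 4 pos g1 := Ck_on_derive (1 : R) gC.
have g2C : Ck_on 3 pos g2 := Ck_on_derive (1 : R) g1C.
have g3C : Ck_on 2 pos g3 := Ck_on_derive (1 : R) g2C.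
have g4C : Ck_on 1 pos g4 := Ck_on_derive (1 : R) g3C.
have df (s : R) (s0 : 0 < s) : is_derive s 1 f (f1 s) := profile_derive fC s0.
have df1 (s : R) (s0 : 0 < s) : is_derive s 1 f1 (f2 s) := profile_derive f1C s0.
have dg (s : R) (s0 : 0 < s) : is_derive s 1 g (g1 s) := profile_derive gC s0.
have dg1 (s : R) (s0 : 0 < s) : is_derive s 1 g1 (g2 s) := profile_derive g1C s0.
have dg2 (s : R) (s0 : 0 < s) : is_derive s 1 g2 (g3 s) := profile_derive g2C s0.
have dg3 (s : R) (s0 : 0 < s) : is_derive s 1 g3 (g4 s) := profile_derive g3C s0.
pose F (s : R) := 2 * f1 s; pose F1 (s : R) := 2 * f2 s.
pose H (s : R) := 4 * g2 s; pose H1 (s : R) := 4 * g3 s; pose H2 (s : R) := 4 * g4 s.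
pose G (s : R) := 2 * g1 s.
(* [K1] and [K2] are the derivatives of [K] expressed through [H], using that [4 g2] is [H]; this
   prepares the elimination of [K] in favour of [G] and [H]. *)
pose K (s : R) := 4 * g1 s + 4 * g2 s * s; pose K1 (s : R) := 2 * H s + s * H1 s.
pose K2 (s : R) := 3 * H1 s + s * H2 s.
have cmul (c d s : R) (k : R -> R) : is_derive s 1 k d -> is_derive s 1 (fun s => c * k s) (c * d).
  move=> dk; apply: is_derive_eq (is_derive_mul1 (is_derive_cst1 c s) dk) _.
  by rewrite mul0r add0r.
have dF (s : R) (s0 : 0 < s) : is_derive s 1 F (F1 s) := cmul 2 _ _ _ (df1 s s0).
have dH (s : R) (s0 : 0 < s) : is_derive s 1 H (H1 s) := cmul 4 _ _ _ (dg2 s s0).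
have dH1 (s : R) (s0 : 0 < s) : is_derive s 1 H1 (H2 s) := cmul 4 _ _ _ (dg3 s s0).
have dK (s : R) : 0 < s -> is_derive s 1 K (K1 s).
  move=> s0; apply: is_derive_eq (is_derive_add1 (cmul 4 _ _ _ (dg1 s s0))
    (is_derive_mul1 (dH s s0) (is_derive_id s 1))) _.
  by rewrite /K1 /H; ring.
have dK1 (s : R) : 0 < s -> is_derive s 1 K1 (K2 s).
  move=> s0; apply: is_derive_eq (is_derive_add1 (cmul 2 _ _ _ (dH s s0))
    (is_derive_mul1 (is_derive_id s 1) (dH1 s s0))) _.
  by rewrite /K2; ring.
have dG (s : R) : 0 < s -> is_derive s 1 G (H s / 2).
  move=> s0; apply: is_derive_eq (cmul 2 _ _ _ (dg1 s s0)) _.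
  by rewrite /H; field.
have U0 x : x != 0 -> U (0, x) = radial_field A B F H K x.
  move=> x0; rewrite -uU // u_rep //.
  exact: (symplectic12_radial_field A B (@Ck_onWn _ _ _ 2 3 _ _ phiC)
    (@Ck_onWn _ _ _ 3 2 _ _ psiC) phir psir x0).
have curl := radial_field_curl B0 AB T0 UU uU PU mom Uodd U0 dF dH dK.
have ode := euler_perpB AB A0 B0 dF dH dK curl.
have [C [d [d0 HC]]] := @radial_second_derivative_bounded R (psi 0) g g1 g2
  (@Ck_onWn _ _ _ 2 3 _ _ psiC) (radial_profileE psir) dg dg1.
have KE (s : R) : K s = 2 * G s + s * H s by rewrite /K /G /H; ring.
have cH2 (s : R) : 0 < s -> {for s, continuous H2}.
  move=> s0; apply: (@continuousM _ _ (cst 4) g4); first exact: cst_continuous.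
  exact: (Ck_on_cont (z := s) g4C s0).
have FH (s : R) : 0 < s -> F s * H s =
     2 * ((2 * H s + s * H1 s) * F s + (2 * G s + s * H s) * F1 s).
  by move=> s0; rewrite (ode s s0).2 KE.
have GM : (forall s : R, 0 < s -> F s = 0) ->
     forall s : R, 0 < s -> G s * (7 * H1 s + 2 * s * H2 s) = 0.
  move=> F0 s s0.
  have F10 := derive0_of_mul_derive0 dF (fun s s0 => (ode s s0).1).
  have := euler_planeAB AB A0 B0 F0 F10 dH dK dH1 dK1 curl s0.
  (* With [K = 2 G + s H] one has [H s - K = - 2 G] and [s H1 + H - K1 = - H]; the terms in [H^2]
     and [H H1] cancel, leaving [- 2 G (7 H1 + 2 s H2)]. *)
  rewrite KE /K1 /K2; move: (G s) (H s) (H1 s) (H2 s) => p h h1 h2 e.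
  have n2 : - 2 != 0 :> R by rewrite oppr_eq0 pnatr_eq0.
  apply: (mulfI n2); rewrite mulr0; apply/eqP; move/eqP: e; rewrite -subr_eq0 => /eqP e.
  by apply/eqP; rewrite -[RHS]e; ring.
have [a [b [c [Fa Hb Gc ab]]]] := profile_of_euler dF dG dH dH1 cH2 d0 HC
  (fun s s0 => (ode s s0).1) FH GM.
apply: (@exceptional_of_profiles R (phi 0) (psi 0) a b c f g _ _ _ _ _ _ ab).
- by move=> x; exact: Ck_on_cont phiC _.
- by move=> x; exact: Ck_on_cont psiC _.
- by move=> x; rewrite {1}(radial_profileE phir).
- by move=> x; rewrite {1}(radial_profileE psir).
- move=> s s0; apply: is_derive_eq (df s s0) _.
  by rewrite -(Fa s s0) /F; field.
- move=> s s0; apply: is_derive_eq (dg s s0) _.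
  by rewrite -(Gc s s0) /G; field.
Qed.

(** * Square integrable exceptional data *)

Lemma affine_ge1 (R : realType) (k0 k1 z : R) : 0 < k1 -> 0 <= k0 ->
  (k0 + 1) / k1 <= z -> k0 + 1 <= k1 * z.
Proof. by move=> k10 k00; rewrite ler_pdivrMr // mulrC. Qed.

(** Not all coefficients vanish, and the one of highest degree that does not decides the behaviour
    for large [z]. *)
Lemma quadratic_sqr_bounded_below (R : realType) (c0 c1 c2 z0 : R) :
  c0 + c1 * z0 + c2 * z0 ^+ 2 != 0 ->
  exists c N : R, 0 < c /\ forall z, N <= z -> c <= (c0 + c1 * z + c2 * z ^+ 2) ^+ 2.
Proof.
move=> q0.
have sq1 (a : R) : 1 <= `|a| -> 1 <= a ^+ 2.
  by move=> a1; rewrite -real_normK ?num_real // expr_ge1.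
have n0 := normr_ge0 c0; have n1 := normr_ge0 c1.
have [c20|c2n] := eqVneq c2 0; last first.
  have k2 : 0 < `|c2| by rewrite normr_gt0.
  (* Beyond this threshold [z] is at least 1 and [|c2| z^2] is at least [(|c0| + |c1| + 1) z], which
     exceeds the lower order terms by at least 1. *)
  exists 1, (1 + (`|c0| + `|c1| + 1) / `|c2|); split=> // z zN; apply: sq1.
  have z1 : 1 <= z.
    by apply: le_trans zN; rewrite lerDl divr_ge0 // ?addr_ge0.
  have kz : `|c0| + `|c1| + 1 <= `|c2| * z.
    apply: affine_ge1; rewrite ?addr_ge0 //.
    by apply: le_trans zN; rewrite lerDr.
  have z0' : 0 <= z by apply: le_trans z1.
  have h : `|c2 * z ^+ 2| <= `|c0 + c1 * z + c2 * z ^+ 2| + (`|c0| + `|c1| * z).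
    rewrite -[in leLHS](addKr (c0 + c1 * z) (c2 * z ^+ 2)) addrC.
    apply: (le_trans (ler_normB _ _)); rewrite lerD2l.
    by apply: (le_trans (ler_normD _ _)); rewrite normrM (ger0_norm z0').
  move: h; rewrite normrM normrX (ger0_norm z0').
  move: (`|c0 + _ + _|) (`|c0|) (`|c1|) (`|c2|) n0 n1 k2 kz => Q a0 a1 a2; nra.
have [c10|c1n] := eqVneq c1 0; last first.
  have k1 : 0 < `|c1| by rewrite normr_gt0.
  exists 1, ((`|c0| + 1) / `|c1|); split=> // z zN; apply: sq1.
  have kz := affine_ge1 k1 n0 zN.
  have z0' : 0 <= z by apply: le_trans zN; rewrite divr_ge0 // addr_ge0.
  rewrite c20 mul0r addr0.
  have : `|c1 * z| <= `|c0 + c1 * z| + `|c0|.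
    rewrite -[in leLHS](addKr c0 (c1 * z)) addrC.
    exact: (le_trans (ler_normB _ _)).
  rewrite normrM (ger0_norm z0'); move: kz.
  move: (`|c0 + _|) (`|c0|) (`|c1|) => Q a0 a1; lra.
exists (c0 ^+ 2), 0; split; last by move=> z _; rewrite c10 c20 !mul0r !addr0.
by move: q0; rewrite c10 c20 !mul0r !addr0 => q0; rewrite exprn_even_gt0.
Qed.

Lemma integral_tail_infty (R : realType) (q : measurableTypeR R -> \bar R) (c N : R) :
  measurable_fun setT q -> (forall z, 0 <= q z)%E -> 0 < c ->
  (forall z : R, N <= z -> (c%:E <= q z)%E) ->
  (\int[@lebesgue_measure R]_z q z = +oo)%E.
Proof.
move=> mq q0 c0 qc; apply/eqP; rewrite -leye_eq.
have mD : measurable ([set` `[N, +oo[%R] : set (measurableTypeR R)) by exact: measurable_itv.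
have -> : (+oo = \int[@lebesgue_measure R]_(z in [set` `[N, +oo[%R]) (cst c%:E) z)%E.
  have mu : lebesgue_measure ([set` `[N, +oo[%R] : set R) = +oo%E.
    by rewrite lebesgue_measure_itv /= ltry addye.
  rewrite integral_cst //.
  rewrite [X in (_ * X)%E]mu.
  by rewrite gt0_muley // lte_fin.
apply: (@le_trans _ _ (\int[@lebesgue_measure R]_(z in [set` `[N, +oo[%R]) q z)%E).
  apply: ge0_le_integral => //.
  - by move=> z _; rewrite lee_fin ltW.
  - exact: measurable_funS mq.
  - by move=> z /=; rewrite in_itv /= andbT; exact: qc.
by apply: ge0_subset_integral => //.
Qed.

(** By Tonelli the inner integral is infinite over every point of [D], a set of nonzero measure. *)
Lemma product_integral_infty (d : measure_display) (T : measurableType d) (R : realType)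
    (m : {sigma_finite_measure set T -> \bar R}) (f : T * measurableTypeR R -> \bar R)
    (D : set T) :
  measurable D -> m D != 0%E -> measurable_fun setT f -> (forall z, 0 <= f z)%E ->
  (forall x, D x -> exists c N : R, 0 < c /\ forall z : R, N <= z -> (c%:E <= f (x, z))%E) ->
  (\int[m \x @lebesgue_measure R]_z f z = +oo)%E.
Proof.
move=> mD D0 mf f0 fD; rewrite (fubini_tonelli1 f mf f0).
have mF := measurable_fun_fubini_tonelli_F (m2 := @lebesgue_measure R) f mf f0.
set F := fubini_F _ f in mF *.
apply/eqP; rewrite -leye_eq.
have <- : (\int[m]_(x in D) cst +oo x = +oo)%E.
  by rewrite integral_cst // gt0_mulye // lt0e D0 /=.
have F0 x : (0 <= F x)%E by apply: integral_ge0 => z _; exact: f0.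
apply: (@le_trans _ _ (\int[m]_(x in D) F x)%E); last exact: ge0_subset_integral.
apply: ge0_le_integral => //.
- by move=> x _; exact: leey.
- exact: measurable_funTS mF.
- move=> x Dx; have [c [N [c0 cN]]] := fD x Dx.
  suff -> : F x = +oo%E by exact: leey.
  apply: (@integral_tail_infty R (fun z => f (x, z)) c N) => //.
  exact: measurableT_comp.
Qed.

(* The canonical structure found for a product measure is the one for
   subprobabilities, so that sigma-finiteness has to be supplied by hand. *)
Lemma lebesgue2_sigma_finite (R : realType) :
  sigma_finite setT (@lebesgue_measure R \x @lebesgue_measure R)%E.
Proof.
have mb (x e : R) : measurable (ball x e : set (measurableTypeR R)) by exact: measurable_ball.
exists (fun n => ball (0 : R) n%:R `*` ball (0 : R) n%:R).
  apply/seteqP; split=> // -[x y] _; exists (Num.truncn (Num.max `|x| `|y|)).+1 => //.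
  have := truncnS_gt (Num.max `|x| `|y|); rewrite gt_max => /andP[hx hy].
  by split; rewrite -ball_normE /= sub0r normrN.
move=> n; split; first exact: measurableX.
have mu := @lebesgue_measure_ball R 0 n%:R (ler0n _ _).
rewrite product_measure1E // (_ : _ * _ = (n%:R *+ 2)%:E * (n%:R *+ 2)%:E)%E; last first.
  by congr (_ * _)%E; exact: mu.
by rewrite -EFinM ltry.
Qed.

(** Were [p] nonzero at a point, continuity in the first two variables would make the quadratic in
    the third one nontrivial over a whole square of positive measure; its square is bounded below
    for large [z] there, so its integral diverges. *)
Lemma L2_quadratic_eq0 (R : realType)
    (p : measurableTypeR R * measurableTypeR R * measurableTypeR R -> R) :
  p \in Lfun (lebesgue3 R) 2%:E ->
  (forall z, continuous (fun xy : R * R => p (xy, z))) ->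
  (forall x y, exists c0 c1 c2 : R, forall z : R, p (x, y, z) = c0 + c1 * z + c2 * z ^+ 2) ->
  forall z, p z = 0.
Proof.
move=> /Lfun2_integrable_sqr /integrableP[mp ip] pc pq [[x0 y0] z0].
apply/eqP; apply: contraT => p0.
have [e e0 He] : exists2 e : R, 0 < e & forall x y : R,
    `|x0 - x| < e -> `|y0 - y| < e -> p (x, y, z0) != 0.
  have H : \forall xy \near ((x0, y0) : R * R), p (xy, z0) != 0.
    exact: cvgr_neq0 (pc z0 (x0, y0)) p0.
  have [e /= e0 He] := (nbhs_ballP _ _).1 H.
  by exists e => // x y xe ye; apply: (He (x, y)); split.
pose D : set (measurableTypeR R * measurableTypeR R) := (ball x0 e) `*` (ball y0 e).
have mb (x : R) : measurable (ball x e : set (measurableTypeR R)) by exact: measurable_ball.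
have mD : measurable D by exact: measurableX.
have D0 : (@lebesgue_measure R \x @lebesgue_measure R)%E D != 0%E.
  have mu (x : R) := lebesgue_measure_ball x (ltW e0).
  rewrite product_measure1E // (_ : _ * _ = (e *+ 2)%:E * (e *+ 2)%:E)%E; last first.
    by congr (_ * _)%E; exact: mu.
  by rewrite -EFinM eqe mulf_neq0 // mulrn_eq0 /= gt_eqF.
move: ip; rewrite (eq_integral (fun z => (EFin \o (fun z => p z ^+ 2)%R) z)); last first.
  by move=> z _ /=; rewrite ger0_norm // sqr_ge0.
suff -> : (\int[lebesgue3 R]_z (EFin \o (fun z => p z ^+ 2)%R) z = +oo)%E by [].
have f0 z : (0 <= (EFin \o (fun z => p z ^+ 2)%R) z)%E by rewrite lee_fin sqr_ge0.
pose m2 : {sigma_finite_measure set (measurableTypeR R * measurableTypeR R)%type -> \bar R} :=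
  HB.pack (@product_measure1 _ _ (measurableTypeR R) (measurableTypeR R) R
    (@lebesgue_measure R) (@lebesgue_measure R))
  (Measure_isSigmaFinite.Build _ _ _ _ (@lebesgue2_sigma_finite R)).
apply: (@product_integral_infty _ _ R m2 (EFin \o (fun z => p z ^+ 2)%R) D mD D0 mp f0).
move=> [x y] [/= xe ye]; have [c0 [c1 [c2 pE]]] := pq x y.
have : p (x, y, z0) != 0.
  by apply: He; [move: xe|move: ye]; rewrite -ball_normE.
rewrite pE => /quadratic_sqr_bounded_below [c [N [cpos cN]]].
by exists c, N; split => // z zN; rewrite lee_fin pE; exact: cN.
Qed.

Lemma vec3_decomp (R : realType) (x y z : R) :
  vec3 x y z = vec3 x y 0 + z *: delta_mx 0 2%:R.
Proof. by apply: eq_rV3; rewrite !(vec3E, mxE) /=; ring. Qed.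

Lemma vec3_continuous (R : realType) (z : R) :
  continuous (fun xy : R * R => vec3 xy.1 xy.2 z).
Proof.
move=> xy; have -> : (fun xy : R * R => vec3 xy.1 xy.2 z) =
    (fun xy : R * R => xy.1 *: delta_mx 0 0 + xy.2 *: delta_mx 0 1 + z *: delta_mx 0 2%:R).
  by apply/funext => p; apply: eq_rV3; rewrite !(vec3E, mxE) /=; ring.
have c0 : {for xy, continuous (fun p : R * R => p.1 *: (delta_mx 0 0 : 'rV[R]_3))}.
  apply: (@continuous_comp _ _ _ fst (fun x : R => x *: delta_mx 0 0)); first exact: cvg_fst.
  exact: scalel_continuous.
have c1 : {for xy, continuous (fun p : R * R => p.2 *: (delta_mx 0 1 : 'rV[R]_3))}.
  apply: (@continuous_comp _ _ _ snd (fun x : R => x *: delta_mx 0 1)); first exact: cvg_snd.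
  exact: scalel_continuous.
have c2 : {for xy, continuous (fun=> z *: (delta_mx 0 2%:R : 'rV[R]_3))} by exact: cst_continuous.
exact: continuousD (continuousD c0 c1) c2.
Qed.

Lemma exceptional_L2_eq0 (R : realType) (A B : 'rV[R]_3) (phi0 psi0 : 'rV[R]_3 -> R)
    (u0 : 'rV[R]_3 -> 'rV[R]_3) :
  continuous u0 -> (forall x, u0 x = symplectic12 A B phi0 psi0 x) ->
  exceptional phi0 psi0 -> in_L2 u0 -> u0 = cst 0.
Proof.
move=> cu0 u0E [f0 [f2 [g0 [g2 [g4 [phiE psiE _]]]]]] u0L.
have en2 (x : 'rV[R]_3) : enorm x ^+ 2 = dot x x by rewrite sqr_sqrtr // dot_ge0.
pose f (s : R) := f2 * s + f0; pose g (s : R) := g4 * (s * s) + (g2 * s + g0).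
have phif : phi0 = fun y => f (dot y y) by apply/funext => y; rewrite phiE en2.
have psig : psi0 = fun y => g (dot y y).
  apply/funext => y; rewrite psiE (_ : enorm y ^+ 4 = dot y y ^+ 2); last by rewrite -en2 -exprM.
  by rewrite en2 /g; ring.
have df (s : R) : is_derive s 1 f f2.
  have D := is_derive_add1 (is_derive_mul1 (is_derive_cst1 f2 s) (is_derive_id s 1))
    (is_derive_cst1 f0 s).
  by apply: is_derive_eq D _; ring.
have dg (s : R) : is_derive s 1 g (2 * g4 * s + g2).
  have D := is_derive_add1 (is_derive_mul1 (is_derive_cst1 g4 s)
      (is_derive_mul1 (is_derive_id s 1) (is_derive_id s 1)))
    (is_derive_add1 (is_derive_mul1 (is_derive_cst1 g2 s) (is_derive_id s 1))
      (is_derive_cst1 g0 s)).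
  by apply: is_derive_eq D _; ring.
have dg1 (s : R) : is_derive s 1 (fun s => 2 * g4 * s + g2) (2 * g4).
  have D := is_derive_add1 (is_derive_mul1 (is_derive_cst1 (2 * g4) s) (is_derive_id s 1))
    (is_derive_cst1 g2 s).
  by apply: is_derive_eq D _; ring.
have uE x : u0 x = (2 * f2) *: crossprod A x + (8 * g4 * dot B x) *: x
    - (16 * g4 * dot x x + 4 * g2) *: B.
  rewrite u0E phif psig (@symplectic12_radial R setT f (fun=> f2) g (fun s => 2 * g4 * s + g2)
    (fun=> 2 * g4)) //; last exact: openT.
  by congr (_ + _ *: _ - _ *: _); ring.
have comp i : forall z, u0 (vec3 z.1.1 z.1.2 z.2) 0 i = 0.
  apply: (L2_quadratic_eq0 (u0L i)).
    move=> z xy; apply: continuous_coord; apply: continuous_comp; last exact: cu0.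
    exact: vec3_continuous.
  move=> x y; pose m := vec3 x y 0; pose e : 'rV[R]_3 := delta_mx 0 2%:R.
  (* Coefficients in [z] of the explicit field at [m + z *: e], using that [m] is orthogonal to the
     unit vector [e]; the bilinear terms supply the middle one. *)
  exists (2 * f2 * crossprod A m 0 i + 8 * g4 * dot B m * m 0 i
    - (16 * g4 * dot m m + 4 * g2) * B 0 i).
  exists (2 * f2 * crossprod A e 0 i + 8 * g4 * (dot B m * e 0 i + dot B e * m 0 i)).
  exists (8 * g4 * dot B e * e 0 i - 16 * g4 * B 0 i).
  move=> z; rewrite /= uE vec3_decomp -/m -/e.
  have me : dot m e = 0 by rewrite dotC /e dot_delta /m vec3E.
  have ee : dot e e = 1 by rewrite /e dot_delta mxE !eqxx.
  rewrite crossDr crossZr !(dotDr, dotDl, dotZr, dotZl) (dotC e) me ee.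
  move: (crossprod A m) (crossprod A e) (dot B m) (dot B e) (dot m m) => p q r s t.
  by rewrite !mxE -/e; ring.
apply/funext => x; apply/rowP => i; rewrite [RHS]mxE.
rewrite (_ : x = vec3 (x 0 0) (x 0 1) (x 0 2%:R)); last by apply: eq_rV3; rewrite vec3E.
exact: (comp i (x 0 0, x 0 1, x 0 2%:R)).
Qed.

Unset Implicit Arguments.
Set Strict Implicit.
Set Printing Implicit Defensive.

(** The conclusion is local at time 0 because the argument is: its negation supplies radial times in
    every interval []0, e[], and these are what transfer symmetry and curl-freeness to the initial
    data. *)
Theorem theorem1p7 (R : realType) (nu T : R) (A B : 'rV[R]_3)
    (u : R -> 'rV[R]_3 -> 'rV[R]_3) (P : R -> 'rV[R]_3 -> R)
    (u0 : 'rV[R]_3 -> 'rV[R]_3)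
    (phi psi : R -> 'rV[R]_3 -> R) (phi0 psi0 : 'rV[R]_3 -> R)
    (nu_gt0 : 0 < nu) (T_gt0 : 0 < T)
    (A_neq0 : A != 0) (B_neq0 : B != 0) (A_perp_B : dot A B = 0)
    (div_u0 : forall x, divergence u0 x = 0)
    (u_sol : NS_solution nu T u P u0)
    (u_rep : forall t x, 0 <= t -> t < T ->
       u t x = symplectic12 A B (phi t) (psi t) x)
    (u0_rep : forall x, u0 x = symplectic12 A B phi0 psi0 x)
    (phi_init : phi 0 = phi0) (psi_init : psi 0 = psi0)
    (phi0_reg : Ck_on 5 setT phi0) (psi0_reg : Ck_on 5 setT psi0)
    (phi_reg : Ck_slab 5 T phi) (psi_reg : Ck_slab 5 T psi) :
  (~ exceptional phi0 psi0 ->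
     \forall t \near 0^'+, ~ (radial (phi t) /\ radial (psi t))) /\
  (u0 <> cst 0 -> in_L2 u0 ->
     \forall t \near 0^'+, ~ (radial (phi t) /\ radial (psi t))).
Proof.
have exc : (forall e : R, 0 < e ->
    exists2 t, 0 < t < e & radial (phi t) /\ radial (psi t)) -> exceptional phi0 psi0.
  rewrite -phi_init -psi_init.
  exact: (exceptional_of_radial_times T_gt0 A_neq0 B_neq0 A_perp_B u_sol u_rep phi_reg psi_reg).
split=> [nexc|u0_neq0 u0_L2]; apply: contrapT => /frequently_of_not_near/exc exc0.
  exact: nexc.
apply: u0_neq0; apply: exceptional_L2_eq0 u0_rep exc0 u0_L2.
have [[U [UU uU]] _ _ _ <-] := u_sol.
have -> : u 0 = fun y => U (0, y) by apply/funext => y; rewrite uU.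
by move=> x; exact: Ck_on_cont (slice_Ck UU T_gt0) _.
Qed.
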